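(* Let $d\geq 2$ and let $\Sigma$ be a closed spherically symmetric Riemannian manifold of dimension $d$, diffeomorphic to $S^d$, that is isometrically embedded in $\mathbb{R}^{d+1}$. Let $A$ be the $d$-dimensional Riemannian volume of $\Sigma$ and $D$ its intrinsic diameter. Then $$\frac{A}{D^d}\leq\frac{|B^d|}{2^{d-1}},$$ where $|B^d|$ is the $d$-dimensional volume of the unit ball $B^d\subset\mathbb{R}^d$.
   Context: Closed means compact and without boundary. $\Sigma$ is spherically symmetric if it is the sphere $S^d$ with a smooth Riemannian metric for which there is a point $p\in\Sigma$ such that, in geodesic spherical coordinates about $p$, which parameterize $\Sigma$ minus $p$ and the cut locus of $p$, the metric reads $ds^2+f_p(s)^2\,d\theta^2$ for $(s,\theta)\in(0,D_p)\times S^{d-1}$. Here $d\theta^2$ is the standard metric of the unit sphere $S^{d-1}$, $D_p>0$ is a number, and $f_p\in C^\infty((0,D_p))$ is a positive function satisfying $f_p''+k_pf_p=0$, $f_p(0)=0$, $f_p'(0)=1$, with $k_p(s)$ the radial curvature (sectional curvature of planes containing the radial direction) at points at distance $s$ from $p$. The isometric embedding is understood as a rotationally symmetric one: $\Sigma$ is obtained by rotating a curve around the $x^1$-axis in $\mathbb{R}^{d+1}$ by the action of $SO(d)$, i.e. the embedding has the form $(s,\theta)\mapsto(z(s),f_p(s)\,\theta)\in\mathbb{R}\times\mathbb{R}^d$ for some function $z$, with $z'(s)^2+f_p'(s)^2=1$. The diameter is $D=\max_{a,b\in\Sigma}\mathrm{dist}(a,b)$, with $\mathrm{dist}$ the geodesic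 distance. *)

(* Defs.v *)
From HB Require Import structures.
From mathcomp Require Import all_boot all_order all_algebra.
From mathcomp Require Import all_classical all_reals all_analysis.

Set Implicit Arguments.
Unset Strict Implicit.
Unset Printing Implicit Defensive.

Import Order.TTheory GRing.Theory Num.Theory.
Import numFieldNormedType.Exports.

Local Open Scope classical_set_scope.
Local Open Scope ring_scope.

(* The library norm on ['rV[R]_n] is the sup norm; it
   induces the usual topology and differential, and all metric notions below
   go through the Euclidean norm [enorm] instead. *)

Definition dotp (R : realType) (n : nat) (u v : 'rV[R]_n) : R :=
  \sum_(i < n) u ord0 i * v ord0 i.

Definition enorm (R : realType) (n : nat) (u : 'rV[R]_n) : R :=
  Num.sqrt (dotp u u).

(* The unit sphere S^(n-1) of R^n. *)
Definition sphere (R : realType) (n : nat) : set 'rV[R]_n :=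
  [set x | enorm x = 1].

(* The Lebesgue integral over R^n of a nonnegative Borel function, as an
   iterated integral (Tonelli). *)
Fixpoint rV_integral (R : realType) (n : nat) :
    ('rV[R]_n -> \bar R) -> \bar R :=
  match n with
  | 0%N => fun f => f 0
  | m.+1 => fun f =>
      (\int[@lebesgue_measure R]_x
         rV_integral (fun v : 'rV[R]_m =>
           f (row_mx (const_mx x : 'rV[R]_1) v : 'rV[R]_(1 + m))))%E
  end.

Definition ball_volume (R : realType) (n : nat) : \bar R :=
  rV_integral (fun x : 'rV[R]_n => (\1_[set y | enorm y <= 1] x)%:E).

Fixpoint Ck (R : realType) (n m k : nat) (F : 'rV[R]_n -> 'rV[R]_m) : Prop :=
  match k with
  | 0%N => continuous F
  | j.+1 => (forall x, differentiable F x) /\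
            (forall v, Ck j (fun x => 'D_v F x))
  end.

Definition Cinfty (R : realType) (n m : nat) (F : 'rV[R]_n -> 'rV[R]_m) : Prop :=
  forall k, Ck k F.

Definition smooth_on_itv (R : realType) (a b : R) (f : R -> R) : Prop :=
  forall (n : nat) (s : R), a < s < b -> derivable (derive1n n f) s 1.

(* Sigma is the image of a smooth embedding of S^d into R^(d+1), that is, a
   closed embedded hypersurface diffeomorphic to S^d. A map is smooth on S^d
   iff it is the restriction of a smooth map of R^(d+1); the tangent space of
   S^d at x is the orthogonal of x. *)
Definition embedded_sphere (R : realType) (d : nat)
    (Sigma : set 'rV[R]_(1 + d)) : Prop :=
  exists F : 'rV[R]_(1 + d) -> 'rV[R]_(1 + d),
    [/\ Cinfty F,
        {in @sphere R (1 + d) &, injective F},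
        (forall x v, sphere x -> dotp x v = 0 -> 'D_v F x = 0 -> v = 0) &
        Sigma = F @` @sphere R (1 + d)].

(* Throughout, Sigma carries the Riemannian metric induced by the Euclidean
   one: this is the original metric, the embedding being isometric. *)

(* C^1 curves on [0, 1] extend to C^1 curves on R, and give the same infimum
   of lengths as piecewise C^1 ones. *)
Definition curve_in (R : realType) (n : nat) (Sigma : set 'rV[R]_n)
    (a b : 'rV[R]_n) (c : R -> 'rV[R]_n) : Prop :=
  [/\ (forall t, derivable c t 1), continuous (derive1 c),
      c 0 = a /\ c 1 = b & forall t, 0 <= t <= 1 -> Sigma (c t)].

Definition curve_length (R : realType) (n : nat) (c : R -> 'rV[R]_n) : \bar R :=
  (\int[@lebesgue_measure R]_(t in `[0%R, 1%R]) (enorm (derive1 c t))%:E)%E.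

Definition geodesic_dist (R : realType) (n : nat) (Sigma : set 'rV[R]_n)
    (a b : 'rV[R]_n) : \bar R :=
  ereal_inf (@curve_length R n @` curve_in Sigma a b).

Definition is_diameter (R : realType) (n : nat) (Sigma : set 'rV[R]_n)
    (D : R) : Prop :=
  (exists a b, [/\ Sigma a, Sigma b & geodesic_dist Sigma a b = D%:E]) /\
  (forall a b, Sigma a -> Sigma b -> (geodesic_dist Sigma a b <= D%:E)%E).

(* C^1 local parametrization X : U -> Sigma of a d-dimensional Sigma. The rows
   of ['J X x] are the partial derivatives of X at x, so that
   [gram X x] is the matrix of the metric in the coordinates X. *)
Definition gram (R : realType) (d n : nat) (X : 'rV[R]_d -> 'rV[R]_n)
    (x : 'rV[R]_d) : 'M[R]_d :=
  jacobian X x *m (jacobian X x)^T.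

Definition local_param (R : realType) (d n : nat) (Sigma : set 'rV[R]_n)
    (U : set 'rV[R]_d) (X : 'rV[R]_d -> 'rV[R]_n) : Prop :=
  [/\ open U,
      (forall x, U x -> differentiable X x /\ {for x, continuous (jacobian X)}),
      (forall x, U x -> row_free (jacobian X x)),
      {in U &, injective X} &
      X @` U `<=` Sigma].

Definition borel_rV (R : realType) (n : nat) :=
  g_sigma_algebraType (@open 'rV[R]_n).

(* mu gives to pieces of the d-dimensional Sigma their Riemannian volume: it
   integrates sqrt(det g_ij) in local coordinates. As finitely many
   coordinate patches cover a compact Sigma, this determines mu on the Borel
   subsets of Sigma. *)
Definition riemannian_volume (R : realType) (d n : nat) (Sigma : set 'rV[R]_n)
    (mu : {measure set (borel_rV R n) -> \bar R}) : Prop :=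
  forall (U : set 'rV[R]_d) (X : 'rV[R]_d -> 'rV[R]_n),
    local_param Sigma U X ->
    mu (X @` U) =
    rV_integral (fun x => (\1_U x * Num.sqrt (\det (gram X x)))%:E).

Definition rot_coord (R : realType) (d : nat) (z f : R -> R)
    (s : R) (th : 'rV[R]_d) : 'rV[R]_(1 + d) :=
  row_mx (const_mx (z s) : 'rV[R]_1) (f s *: th).

(* In geodesic spherical coordinates Phi that have the same cut distance Dp in
   every direction, the cut locus consists of the end points, at arc length
   Dp, of the radial geodesics. *)
Definition cut_locus (R : realType) (d : nat) (Dp : R)
    (Phi : R -> 'rV[R]_d -> 'rV[R]_(1 + d)) : set 'rV[R]_(1 + d) :=
  [set q | exists2 th, sphere th & Phi s th @[s --> Dp^'-] --> q].

(* (s, th) |-> (z(s), f(s) th) is a system of geodesic spherical coordinates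
   about p on Sigma minus p and the cut locus of p. Its induced metric is
   (z'^2 + f'^2) ds^2 + f^2 dth^2, hence ds^2 + f^2 dth^2 by [gsc_arclength].
   As f is only defined on (0, Dp), its data at 0 are limits. The sectional
   curvature of radial planes for ds^2 + f^2 dth^2 is - f'' / f, which is the
   function k singled out by [gsc_curvature]. *)
Record geodesic_spherical_coord (R : realType) (d : nat)
    (Sigma : set 'rV[R]_(1 + d)) (p : 'rV[R]_(1 + d)) (Dp : R)
    (f k z : R -> R) : Prop := {
  gsc_p : Sigma p ;
  gsc_Dp : 0 < Dp ;
  gsc_f_smooth : smooth_on_itv 0 Dp f ;
  gsc_f_gt0 : forall s : R, 0 < s < Dp -> 0 < f s ;
  gsc_curvature : forall s : R, 0 < s < Dp -> derive1n 2 f s + k s * f s = 0 ;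
  gsc_f0 : f s @[s --> (0 : R)^'+] --> (0 : R) ;
  gsc_df0 : derive1 f s @[s --> (0 : R)^'+] --> (1 : R) ;
  gsc_z_smooth : smooth_on_itv 0 Dp z ;
  gsc_arclength : forall s : R, 0 < s < Dp -> (derive1 z s) ^+ 2 + (derive1 f s) ^+ 2 = 1 ;
  gsc_center : forall th : 'rV[R]_d, sphere th ->
    rot_coord z f s th @[s --> (0 : R)^'+] --> p ;
  gsc_inj : forall (s1 s2 : R) (th1 th2 : 'rV[R]_d), 0 < s1 < Dp -> 0 < s2 < Dp ->
    sphere th1 -> sphere th2 ->
    rot_coord z f s1 th1 = rot_coord z f s2 th2 -> s1 = s2 /\ th1 = th2 ;
  gsc_image :
    [set x | exists (s : R) (th : 'rV[R]_d), [/\ 0 < s < Dp, sphere th & x = rot_coord z f s th]] =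
    Sigma `\` ([set p] `|` cut_locus Dp (@rot_coord R d z f))
}.

Definition spherically_symmetric (R : realType) (d : nat)
    (Sigma : set 'rV[R]_(1 + d)) : Prop :=
  exists p Dp f k z, geodesic_spherical_coord Sigma p Dp f k z.

(* Main.v *)
Require Import Defs.
From HB Require Import structures.
From mathcomp Require Import all_boot all_order all_algebra.
From mathcomp Require Import all_classical all_reals all_analysis.
From mathcomp Require Import measurable_realfun ring lra.
Import Order.TTheory GRing.Theory Num.Theory.
Import numFieldNormedType.Exports.
Local Open Scope classical_set_scope.
Local Open Scope ring_scope.

Set Implicit Arguments.
Unset Strict Implicit.
Unset Printing Implicit Defensive.

(** Let [(z, f)] be the profile curve of [Sigma], parametrized by arc length on [[0, L]]. Since
    [f] vanishes at the pole [s = 0] and [|f'| <= 1], the radius satisfies [f s <= s]. Hence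
    the chart [s *: th |-> (z s, f s *: th)] of the cap of radius [a] around the pole, defined on
    the Euclidean ball of radius [a], does not increase volumes: it is isometric along radii
    and contracts the other directions by the ratio [f s / s]. So the volume of a cap is at
    most [|B^d| a^d] ([polar_cap_volume]). The same holds around the other end
    [s = L], and caps of radius slightly larger than [L / 2] around both ends cover [Sigma].
    The volume is therefore at most [2 |B^d| (L / 2)^d] ([area_le]). As the distance of the
    poles is at least [L] ([pole_distance_le]), the diameter is at least [L], and the
    inequality follows.

    This uses that the other end is a second pole, with [f L = 0], and this is where the
    hypothesis that [Sigma] is a smooth sphere enters. At each point [q] an
    embedded sphere has a normal almost orthogonal to all chords near [q], and every
    vector orthogonal to the normal is the velocity of a curve of [Sigma]
    ([embedded_sphere_normal]). If [f L] were positive, [Sigma] would have a boundary, the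
    parallel [s = L]: some curve of [Sigma] would cross it with a velocity in the meridian plane,
    whereas the points of the profile close to [s = L] all lie on one side
    ([profile_end]). Once [f L = 0], the normal at the second pole is parallel to the axis;
    almost orthogonality to the chords then shows that the profile is smooth there
    ([second_pole_dz], [second_pole_df]) and that the two poles differ
    ([poles_distinct]).

    For the distance of the poles, the parameter [s] of a moving point of [Sigma] is
    followed along a curve from one pole to the other. It is continuous by
    compactness, and differentiable with derivative at most the speed of the curve, because
    the profile has unit speed ([profile_length]). *)

(** * Euclidean scalar product and norm *)

Section Euclid.
Context {R : realType} {n : nat}.
Implicit Types u v w : 'rV[R]_n.

Lemma dotpC u v : dotp u v = dotp v u.
Proof. by apply: eq_bigr => i _; rewrite mulrC. Qed.

Lemma dotpDl u v w : dotp (u + v) w = dotp u w + dotp v w.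
Proof. by rewrite -big_split; apply: eq_bigr => i _; rewrite mxE mulrDl. Qed.

Lemma dotpZl a u v : dotp (a *: u) v = a * dotp u v.
Proof. by rewrite mulr_sumr; apply: eq_bigr => i _; rewrite mxE mulrA. Qed.

Lemma dotpDr u v w : dotp u (v + w) = dotp u v + dotp u w.
Proof. by rewrite dotpC dotpDl !(dotpC u). Qed.

Lemma dotpZr a u v : dotp u (a *: v) = a * dotp u v.
Proof. by rewrite dotpC dotpZl (dotpC u). Qed.

Lemma dotpNl u v : dotp (- u) v = - dotp u v.
Proof. by rewrite -scaleN1r dotpZl mulN1r. Qed.

Lemma dotpNr u v : dotp u (- v) = - dotp u v.
Proof. by rewrite dotpC dotpNl (dotpC u). Qed.

Lemma dotpBl u v w : dotp (u - v) w = dotp u w - dotp v w.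
Proof. by rewrite dotpDl dotpNl. Qed.

Lemma dotpBr u v w : dotp u (v - w) = dotp u v - dotp u w.
Proof. by rewrite dotpDr dotpNr. Qed.

Lemma dotp0l u : dotp 0 u = 0.
Proof. by rewrite -(scale0r u) dotpZl mul0r. Qed.

Lemma dotp0r u : dotp u 0 = 0.
Proof. by rewrite dotpC dotp0l. Qed.

Lemma dotp_ge0 u : 0 <= dotp u u.
Proof. by apply: sumr_ge0 => i _; rewrite -expr2 sqr_ge0. Qed.

Lemma dotp_eq0 u : (dotp u u == 0) = (u == 0).
Proof.
apply/idP/eqP => [|->]; last by rewrite dotp0l.
rewrite psumr_eq0 => [/allP u0|i _]; last by rewrite -expr2 sqr_ge0.
apply/rowP => i; rewrite mxE.
by have := u0 i (mem_index_enum i); rewrite mulf_eq0 orbb => /eqP.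
Qed.

Lemma dotp_delta u i : dotp u (delta_mx 0 i) = u 0 i.
Proof.
rewrite /dotp (bigD1 i)//= big1 => [|j ji].
  by rewrite addr0 mxE !eqxx mulr1.
by rewrite mxE (negbTE ji) andbF mulr0.
Qed.

Lemma mulmx_trE u v : u *m v^T = (dotp u v)%:M.
Proof.
apply/matrixP => i j; rewrite !ord1 !mxE eqxx mulr1n.
by apply: eq_bigr => k _; rewrite mxE.
Qed.

Lemma enorm_ge0 u : 0 <= enorm u.
Proof. exact: sqrtr_ge0. Qed.

Lemma sqr_enorm u : enorm u ^+ 2 = dotp u u.
Proof. by rewrite sqr_sqrtr// dotp_ge0. Qed.

Lemma enormZ a u : enorm (a *: u) = `|a| * enorm u.
Proof.
by rewrite /enorm dotpZl dotpZr mulrA -expr2 sqrtrM ?sqr_ge0// sqrtr_sqr.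
Qed.

Lemma enorm_eq0 u : (enorm u == 0) = (u == 0).
Proof. by rewrite -sqrf_eq0 sqr_enorm dotp_eq0. Qed.

Lemma enorm0 : enorm (0 : 'rV[R]_n) = 0.
Proof. by apply/eqP; rewrite enorm_eq0. Qed.

Lemma enorm_gt0 u : (0 < enorm u) = (u != 0).
Proof. by rewrite lt0r enorm_eq0 enorm_ge0 andbT. Qed.

Lemma enorm_le u a : 0 <= a -> (enorm u <= a) = (dotp u u <= a ^+ 2).
Proof. by move=> a0; rewrite -sqr_enorm ler_sqr// nnegrE ?enorm_ge0. Qed.

Lemma sphere_dotp u : sphere u <-> dotp u u = 1.
Proof.
rewrite /sphere/=; split=> [u1|u1]; first by rewrite -sqr_enorm u1 expr1n.
by rewrite /enorm u1 sqrtr1.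
Qed.

Lemma sphere_normalize u : u != 0 -> sphere ((enorm u)^-1 *: u).
Proof.
move=> u0; rewrite /sphere/= enormZ normfV ger0_norm ?enorm_ge0//.
by rewrite mulVf// enorm_eq0.
Qed.

(** Expand the square of the norm of [dotp v v *: u - dotp u v *: v]. *)
Lemma dotp_CS u v : dotp u v ^+ 2 <= dotp u u * dotp v v.
Proof.
have [->|v0] := eqVneq v 0; first by rewrite !dotp0r expr0n mulr0.
have vv : 0 < dotp v v by rewrite lt0r dotp_eq0 v0 dotp_ge0.
have := dotp_ge0 (dotp v v *: u - dotp u v *: v).
have -> : dotp (dotp v v *: u - dotp u v *: v) (dotp v v *: u - dotp u v *: v) =
    dotp v v * (dotp u u * dotp v v - dotp u v ^+ 2).
  by rewrite !(dotpBl, dotpBr, dotpZl, dotpZr) (dotpC v u); ring.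
by rewrite pmulr_rge0// subr_ge0.
Qed.

Lemma coord_le_enorm u i : `|u 0 i| <= enorm u.
Proof.
rewrite -sqrtr_sqr ler_sqrt ?dotp_ge0// /dotp (bigD1 i)//= -expr2 lerDl.
by apply: sumr_ge0 => j _; rewrite -expr2 sqr_ge0.
Qed.

Lemma coord_le_norm u i : `|u 0 i| <= `|u|.
Proof. by rewrite [leRHS]/Num.Def.normr/= mx_normrE (le_bigmax _ _ (0, i)). Qed.

Lemma rV_norm_le u a : 0 <= a -> (forall i, `|u 0 i| <= a) -> `|u| <= a.
Proof.
move=> a0 ua; rewrite [leLHS]/Num.Def.normr/= mx_normrE.
by apply: bigmax_le => // -[i j] _; rewrite ord1.
Qed.

Lemma norm_le_enorm u : `|u| <= enorm u.
Proof. by apply: rV_norm_le => [|i]; rewrite ?enorm_ge0 ?coord_le_enorm. Qed.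

Lemma dotp_le_norm u v : `|dotp u v| <= n%:R * `|u| * `|v|.
Proof.
apply: le_trans (ler_norm_sum _ _ _) _.
rewrite -mulrA -[X in X%:R]card_ord -sum1_card natr_sum mulr_suml.
by apply: ler_sum => i _; rewrite mul1r normrM ler_pM// coord_le_norm.
Qed.

Lemma enorm_le_norm u : enorm u <= n%:R * `|u|.
Proof.
rewrite enorm_le ?mulr_ge0//; apply: le_trans (ler_norm _) _.
apply: le_trans (dotp_le_norm _ _) _.
rewrite exprMn !expr2 -!mulrA; case: n u => [|m] u; first by rewrite !mul0r.
by rewrite ler_peMl ?mulr_ge0// ler1n.
Qed.

Lemma cvg_coord {T : Type} {F : set_system T} {FF : Filter F}
    (f : T -> 'rV[R]_n) (l : 'rV[R]_n) i :
  f @ F --> l -> f x 0 i @[x --> F] --> l 0 i.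
Proof.
move=> fl; apply: (cvg_comp f (fun M : 'rV[R]_n => M 0 i) fl).
exact: coord_continuous.
Qed.

Lemma cvg_rV {T : Type} {F : set_system T} {FF : Filter F}
    (f : T -> 'rV[R]_n) (l : 'rV[R]_n) :
  (forall i, f x 0 i @[x --> F] --> l 0 i) -> f @ F --> l.
Proof.
move=> fl; apply/cvgrPdist_le => e e0.
have : \forall x \near F, forall i, `|l 0 i - f x 0 i| <= e.
  by apply: filter_forall => i; move/cvgrPdist_le : (fl i); exact.
apply: filterS => x xe; apply: rV_norm_le => [|i]; first exact: ltW.
by rewrite !mxE.
Qed.

Lemma cvg_dotp {T : Type} {F : set_system T} {FF : Filter F}
    (f g : T -> 'rV[R]_n) (a b : 'rV[R]_n) :
  f @ F --> a -> g @ F --> b -> dotp (f x) (g x) @[x --> F] --> dotp a b.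
Proof.
move=> fa gb; rewrite /dotp.
apply: cvg_big => [|i _]; first exact: add_continuous.
by apply: cvgM; exact: cvg_coord.
Qed.

Lemma continuous_enorm : continuous (@enorm R n).
Proof.
move=> u; apply: (@continuous_comp _ _ _ (fun v => dotp v v) Num.sqrt).
  by apply: (@cvg_dotp _ (nbhs u) _ id id); exact: cvg_id.
exact: sqrt_continuous.
Qed.

End Euclid.

Lemma dotp_row_mx (R : realType) (m n : nat) (a c : 'rV[R]_m) (b d : 'rV[R]_n) :
  dotp (row_mx a b) (row_mx c d) = dotp a c + dotp b d.
Proof.
rewrite /dotp big_split_ord/=.
by congr (_ + _); apply: eq_bigr => i _; rewrite ?row_mxEl ?row_mxEr.
Qed.

Lemma dotp_const (R : realType) (a b : R) :
  dotp (const_mx a : 'rV_1) (const_mx b) = a * b.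
Proof. by rewrite /dotp big_ord1 !mxE. Qed.

(** * Iterated integrals and the volume of balls *)

Section RVIntegral.
Context {R : realType}.
Local Open Scope ereal_scope.

Lemma eq_indic (T U : Type) (A : set T) (B : set U) x y :
  (A x <-> B y) -> \1_A x = \1_B y :> R.
Proof.
move=> AB; rewrite !indicE; congr ((nat_of_bool _)%:R).
by apply/idP/idP; rewrite !inE => /AB.
Qed.

(** Both sides are suprema of integrals over the simple functions that lie below the
    integrand, so that arbitrary functions can be compared. *)
Lemma ge0_le_integralT d (T : measurableType d) (mu : {measure set T -> \bar R})
    (f g : T -> \bar R) :
  (forall x, 0 <= f x) -> (forall x, f x <= g x) ->
  \int[mu]_x f x <= \int[mu]_x g x.
Proof.
move=> f0 fg; have g0 x : 0 <= g x by exact: le_trans (f0 x) (fg x).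
rewrite !ge0_integralTE//; apply: le_ereal_sup => _ /= [h hf <-].
by exists h => // x; exact: le_trans (fg x).
Qed.

Lemma rV_integral_ge0 n (f : 'rV[R]_n -> \bar R) :
  (forall x, 0 <= f x) -> 0 <= rV_integral f.
Proof.
elim: n f => [|n IH] f f0 //=.
by apply: integral_ge0 => x _; exact: IH.
Qed.

Lemma le_rV_integral n (f g : 'rV[R]_n -> \bar R) :
  (forall x, 0 <= f x) -> (forall x, f x <= g x) ->
  rV_integral f <= rV_integral g.
Proof.
elim: n f g => [|n IH] f g f0 fg //=.
apply: ge0_le_integralT => x; first exact: rV_integral_ge0.
exact: IH.
Qed.

(** The Lebesgue measure is the only measure giving their length to intervals,
    so it is [a] times its image under the dilation of ratio [a]. *)
Lemma integral_dilation (a : R) (g : measurableTypeR R -> \bar R) : (0 < a)%R ->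
  measurable_fun setT g -> (forall x, 0 <= g x) ->
  \int[lebesgue_measure]_x g x = a%:E * \int[lebesgue_measure]_x g (a * x)%R.
Proof.
move=> a0 mg g0.
have mphi : measurable_fun [set: measurableTypeR R]
   ( *%R a : _ -> measurableTypeR R) by exact: mulrl_measurable.
pose nu0 := mscale (NngNum (ltW a0))
  (pushforward lebesgue_measure ( *%R a : _ -> measurableTypeR R)).
pose nu : {measure set (measurableTypeR R) -> \bar R} := nu0 mphi.
have nuE A : measurable A -> lebesgue_measure A = nu A.
  apply: lebesgue_measure_unique => X /ocitvP[->|[[u v]/= uv ->]].
    by rewrite !measure0.
  rewrite /nu /nu0 /= /mscale/= /pushforward.
  have -> : ( *%R a @^-1` `]u, v] = `](a^-1 * u)%R, (a^-1 * v)%R])%classic.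
    apply/seteqP; split => x /=; rewrite !in_itv/=.
      by rewrite ltr_pdivrMl// ler_pdivlMl.
    by rewrite ltr_pdivrMl// ler_pdivlMl.
  rewrite !lebesgue_measure_itv/= !lte_fin ltr_pM2l ?invr_gt0// uv.
  by rewrite -!EFinB -EFinM -mulrBr mulrA mulfV ?gt_eqF// mul1r.
rewrite (@eq_measure_integral _ _ _ setT nu)//; last by move=> A + _; exact: nuE.
rewrite ge0_integral_mscale//=; congr (_ * _).
by rewrite ge0_integral_pushforward.
Qed.

(** Balls are indexed by the square of their radius: the slice of such a ball at abscissa [x]
    is then the ball of index [r - x ^+ 2], which gives an induction on the dimension. *)
Definition ball_volume2 n (r : R) : \bar R :=
  rV_integral (fun x : 'rV[R]_n => (\1_[set y | (dotp y y <= r)%R] x)%:E).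

Lemma ball_volume2S n (r : R) : ball_volume2 n.+1 r =
  \int[@lebesgue_measure R]_x ball_volume2 n (r - x ^+ 2)%R.
Proof.
apply: eq_integral => x _; congr rV_integral; apply/funext => v /=.
congr EFin; apply: eq_indic => /=.
have := dotp_row_mx (const_mx x : 'rV[R]_1) (const_mx x) v v.
by rewrite dotp_const -expr2 => ->; rewrite lerBrDl.
Qed.

Lemma ball_volume2_ge0 n r : 0 <= ball_volume2 n r.
Proof. by apply: rV_integral_ge0 => x; rewrite lee_fin. Qed.

Lemma le_ball_volume2 n (r s : R) : (r <= s)%R ->
  ball_volume2 n r <= ball_volume2 n s.
Proof.
move=> rs; apply: le_rV_integral => x; rewrite lee_fin// !indicE ler_nat.
have [/set_mem xr|//] := boolP (x \in [set y | (dotp y y <= r)%R]).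
by rewrite mem_set//=; exact: le_trans rs.
Qed.

Lemma measurable_ball_volume2 n (r : R) :
  measurable_fun setT (fun x : measurableTypeR R => ball_volume2 n (r - x ^+ 2)).
Proof.
have m1 : measurable_fun setT (ball_volume2 n : measurableTypeR R -> _).
  apply: (measurability _ (ErealGenOInfty.measurableE R)) => _ /= [_ [c ->] <-].
  rewrite setTI; apply: is_interval_measurable => x y /= xI yI z /andP[xz _].
  move: xI; rewrite !in_itv/= !andbT => /lt_le_trans; apply.
  exact: le_ball_volume2.
by apply: (measurableT_comp m1); apply: measurable_funB => //; exact: measurable_funX.
Qed.

Lemma ball_volume2Z n (a r : R) : (0 < a)%R ->
  ball_volume2 n (a ^+ 2 * r) = (a ^+ n)%:E * ball_volume2 n r.
Proof.
move=> a0; elim: n r => [|n IH] r.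
  rewrite mul1e /ball_volume2/=; congr EFin; apply: eq_indic.
  by rewrite /= /dotp !big_ord0 pmulr_rge0// exprn_gt0.
rewrite !ball_volume2S (@integral_dilation a)//; last 2 first.
- exact: measurable_ball_volume2.
- by move=> x; exact: ball_volume2_ge0.
rewrite (exprS a n) EFinM -muleA; congr (_ * _)%E.
rewrite -ge0_integralZl//; last 3 first.
- exact: measurable_ball_volume2.
- by move=> x _; exact: ball_volume2_ge0.
- by rewrite lee_fin exprn_ge0// ltW.
by apply: eq_integral => x _; rewrite -IH mulrBr exprMn.
Qed.

Lemma ball_volumeE n : ball_volume R n = ball_volume2 n 1.
Proof.
congr rV_integral; apply/funext => x; congr EFin; apply: eq_indic.
by rewrite /= enorm_le// expr1n.
Qed.

Lemma ball_volume_scale n (a : R) : (0 < a)%R ->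
  rV_integral (fun x : 'rV[R]_n => (\1_[set y | (enorm y <= a)%R] x)%:E) =
  (a ^+ n)%:E * ball_volume R n.
Proof.
move=> a0; rewrite ball_volumeE -ball_volume2Z// mulr1.
congr rV_integral; apply/funext => x; congr EFin; apply: eq_indic.
by rewrite /= enorm_le// ltW.
Qed.

End RVIntegral.

(** * Determinant of a rank one perturbation of a scalar matrix *)

(** Both sides are the determinant of one block matrix, computed by eliminating one or the
    other of its two diagonal blocks. *)
Lemma det_scalar_rank1 (F : fieldType) (n : nat) (a b : F) (u : 'rV[F]_n) :
  a != 0 -> \det (a%:M + b *: (u^T *m u)) =
  a ^+ n * (1 + b / a * (u *m u^T) 0 0).
Proof.
move=> a0.
pose M := block_mx (1%:M : 'M[F]_1) (- u) (b *: u^T) (a%:M).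
pose Lo := block_mx (1%:M : 'M[F]_1) 0 (- (b *: u^T)) (1%:M : 'M[F]_n).
pose Up := block_mx (1%:M : 'M[F]_1) (a^-1 *: u) 0 (1%:M : 'M[F]_n).
have E1 : \det M = \det (a%:M + b *: (u^T *m u)).
  have : Lo *m M = block_mx 1%:M (- u) 0 (a%:M + b *: (u^T *m u)).
    rewrite /Lo /M mulmx_block !mul1mx !mul0mx !addr0 mulmx1 addrC subrr.
    by rewrite mulNmx mulmxN opprK -scalemxAl addrC.
  move/(congr1 determinant); rewrite det_mulmx det_lblock det_ublock !det1.
  by rewrite !mul1r.
have E2 : \det M = a ^+ n * (1 + b / a * (u *m u^T) 0 0).
  have : Up *m M = block_mx (1%:M + (b / a) *: (u *m u^T)) 0 (b *: u^T) a%:M.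
    rewrite /Up /M mulmx_block !mul1mx !mul0mx !add0r; congr block_mx.
      by rewrite -scalemxAl -scalemxAr scalerA mulrC.
    by rewrite mul_mx_scalar scalerA mulfV// scale1r addNr.
  move/(congr1 determinant); rewrite det_mulmx det_lblock det_ublock !det1.
  by rewrite !mul1r det_scalar det_mx11 !mxE eqxx mulrC => ->.
by rewrite -E1 E2.
Qed.

(** * Differentiability in coordinates *)

Section Differentiation.
Context {R : realType}.

Lemma is_diff_eps (V W : normedModType R) (g : V -> W) (dg : {linear V -> W})
    (x : V) : continuous dg ->
  (forall e : R, 0 < e -> \forall h \near 0, `|g (h + x) - g x - dg h| <= e * `|h|) ->
  is_diff x g dg.
Proof.
move=> cdg H.
have E : g \o shift x = cst (g x) + dg +o_ 0 id.
  apply/eqaddoP => e e0; apply: filterS (H e e0) => h /=.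
  by rewrite /= opprD addrA.
have D : 'd g x = dg :> (V -> W) by exact: diff_unique.
by apply: DiffDef => //; apply/diff_locallyP; rewrite D.
Qed.

Lemma differentiable_rV (V : normedModType R) n (F : V -> 'rV[R]_n) (x : V) :
  (forall j, differentiable (fun y => F y 0 j) x) -> differentiable F x.
Proof.
move=> dF.
have -> : F = \sum_(j < n) (fun y => F y 0 j *: delta_mx 0 j).
  apply/funext => y; rewrite fct_sumE; exact: row_sum_delta.
by apply: differentiable_sum => j; exact: differentiableZl.
Qed.

Lemma jacobianE n m (F : 'rV[R]_n -> 'rV[R]_m) x i j : differentiable F x ->
  jacobian F x i j = 'd (fun y => F y 0 j) x (delta_mx 0 i).
Proof.
move=> dF.
have dFj : differentiable (fun y => F y 0 j) x.
  apply: (@differentiable_comp _ _ _ _ F (fun M : 'rV[R]_m => M 0 j)) => //.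
  exact: differentiable_coord.
rewrite -deriveE//.
have := deriveEjacobian (delta_mx 0 i) dF; rewrite -rowE => /rowP/(_ j).
rewrite [RHS]mxE => <-.
by rewrite derive_mx ?mxE//; exact: diff_derivable.
Qed.

Lemma is_diff_dotp_self n (x : 'rV[R]_n) :
  is_diff x (fun y => dotp y y) (fun v => 2 * dotp x v).
Proof.
have lin : linear (fun v => 2 * dotp x v).
  by move=> a u v; rewrite dotpDr dotpZr mulrDr mulrCA.
pose L : {linear 'rV[R]_n -> R} := HB.pack (fun v => 2 * dotp x v)
  (GRing.isLinear.Build _ _ _ _ _ lin).
apply: (@is_diff_eps _ _ _ L).
  move=> v; have H : dotp x y @[y --> v] --> dotp x v.
    by apply: (@cvg_dotp _ _ _ (nbhs v) _ (fun=> x) id); [exact: cvg_cst|exact: cvg_id].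
  exact: (cvgM (cvg_cst (2 : R)) H).
move=> e e0.
have d0 : 0 < e / (n%:R + 1) by rewrite divr_gt0// ltr_wpDl.
near=> h.
rewrite /= dotpDl !dotpDr (dotpC h x).
rewrite (_ : _ - _ = dotp h h); last by ring.
apply: le_trans (dotp_le_norm _ _) _; rewrite ler_wpM2r//.
apply: (@le_trans _ _ (n%:R * (e / (n%:R + 1)))).
  by rewrite ler_wpM2l//; near: h; exact: nbhs0_le.
rewrite mulrCA; apply: ler_piMr; first exact: ltW.
by rewrite ler_pdivrMr ?ltr_wpDl// mul1r lerDl.
Unshelve. all: by end_near. Qed.

Lemma is_diff_enorm n (x : 'rV[R]_n) : x != 0 ->
  is_diff x (@enorm R n) (fun v => dotp x v / enorm x).
Proof.
move=> x0; have xx : 0 < dotp x x by rewrite lt0r dotp_eq0 x0 dotp_ge0.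
have ds : is_diff (dotp x x) (@Num.sqrt R) (fun t => t *: (2 * enorm x)^-1).
  have D := is_derive1_sqrt xx.
  have d1 : derivable (@Num.sqrt R) (dotp x x) 1 by exact: ex_derive.
  apply: DiffDef; first exact/derivable1_diffP.
  by rewrite deriv1E// derive1E derive_val.
apply: (@is_diff_eq _ _ _ (@enorm R n) _ _ _ (is_diff_comp (is_diff_dotp_self x) ds)).
apply/funext => v /=.
by rewrite /GRing.scale/= invfM mulrA (mulrC 2) -(mulrA (dotp x v)) mulfV ?mulr1.
Qed.

(** [x / enorm x] is the gradient of the norm. *)
Lemma is_diff_radial n (x : 'rV[R]_n) (h : R -> R) (dh : R) : x != 0 ->
  is_derive (enorm x) 1 h dh ->
  is_diff x (fun y => h (enorm y)) (fun v => dh * (dotp x v / enorm x)).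
Proof.
move=> x0 D.
have d1 : derivable h (enorm x) 1 by exact: ex_derive.
have dsh : is_diff (enorm x) h (fun t => t *: dh).
  apply: DiffDef; first exact/derivable1_diffP.
  by rewrite deriv1E// derive1E derive_val.
apply: (@is_diff_eq _ _ _ (fun y => h (enorm y)) _ _ _
  (is_diff_comp (is_diff_enorm x0) dsh)).
by apply/funext => v /=; rewrite /GRing.scale/= mulrC.
Qed.

Lemma cvg_mx {T : Type} {F : set_system T} {FF : Filter F} m n
    (f : T -> 'M[R]_(m, n)) (l : 'M[R]_(m, n)) :
  (forall i j, f x i j @[x --> F] --> l i j) -> f @ F --> l.
Proof.
move=> fl; apply/cvgrPdist_le => e e0.
have : \forall x \near F, forall ij : 'I_m * 'I_n, `|l ij.1 ij.2 - f x ij.1 ij.2| <= e.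
  by apply: filter_forall => -[i j]; move/cvgrPdist_le : (fl i j); exact.
apply: filterS => x xe; rewrite [leLHS]/Num.Def.normr/= mx_normrE.
by apply: bigmax_le => [|ij _]; [exact: ltW|rewrite !mxE xe].
Qed.

Lemma continuous_rV (T : topologicalType) n (F : T -> 'rV[R]_n) :
  (forall j, continuous (fun y => F y 0 j)) -> continuous F.
Proof. by move=> cF x; apply: (@cvg_rV _ _ T (nbhs x)) => i; exact: cF. Qed.

Lemma cvg_at_dist (T : topologicalType) (W : normedModType R) (F : T -> W) x :
  (forall e : R, 0 < e -> \forall y \near x, `|F x - F y| <= e) ->
  F y @[y --> x] --> F x.
Proof. by move=> H; apply/cvgrPdist_le. Qed.

Lemma near_at_dist (T : topologicalType) (W : normedModType R) (F : T -> W) x :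
  F y @[y --> x] --> F x ->
  forall e : R, 0 < e -> \forall y \near x, `|F x - F y| <= e.
Proof. by move/cvgrPdist_le. Qed.

Lemma cvg_at_mx (T : topologicalType) m n (F : T -> 'M[R]_(m, n)) x :
  (forall i j, F y i j @[y --> x] --> F x i j) -> F y @[y --> x] --> F x.
Proof. exact: cvg_mx. Qed.

(** The mean value inequality up to an end point at which [g] only has a limit. *)
Lemma mvt_at_right (a l c e : R) (g : R -> R) :
  (forall s, 0 < s < a -> derivable g s 1) ->
  (forall s, 0 < s < a -> `|derive1 g s - c| <= e) ->
  g s @[s --> 0^'+] --> l ->
  forall s, 0 < s < a -> `|g s - l - c * s| <= e * s.
Proof.
move=> dg ge gl s /andP[s0 sa].
have B t : 0 < t < s -> `|g s - g t - c * (s - t)| <= e * (s - t).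
  move=> /andP[t0 ts].
  have dts x : x \in `]t, s[ -> 0 < x < a.
    by rewrite in_itv/= => /andP[tx xs]; rewrite (lt_trans t0)//= (lt_trans xs).
  have ctn : {within `[t, s], continuous g}.
    apply: derivable_within_continuous => x; rewrite in_itv/= => /andP[tx xs].
    by apply: dg; rewrite (lt_le_trans t0)//= (le_lt_trans xs).
  have [x xts ->] := MVT ts (fun x xi => derivableP (dg x (dts x xi))) ctn.
  rewrite -mulrBl normrM (gtr0_norm (_ : 0 < s - t)) ?subr_gt0//.
  apply: ler_wpM2r; first by rewrite subr_ge0 ltW.
  by rewrite -derive1E; apply: ge; exact: dts.
have L1 : `|g s - g t - c * (s - t)| @[t --> 0^'+] --> `|g s - l - c * (s - 0)|.
  apply: cvg_norm; apply: cvgB; first by apply: cvgB => //; exact: cvg_cst.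
  apply: cvgM; [exact: cvg_cst|apply: cvgB; first exact: cvg_cst].
  by apply: cvg_at_right_filter; exact: cvg_id.
have L2 : e * (s - t) @[t --> 0^'+] --> e * (s - 0).
  apply: cvgM; [exact: cvg_cst|apply: cvgB; first exact: cvg_cst].
  by apply: cvg_at_right_filter; exact: cvg_id.
rewrite -{2 3}(subr0 s); apply: ler_cvg_to L1 L2 _.
near=> t; apply: B; apply/andP; split; near: t; first exact: nbhs_right_gt.
exact: nbhs_right_lt.
Unshelve. all: by end_near. Qed.

Lemma near_enorm n (P : R -> Prop) : (\forall s \near 0^'+, P s) ->
  \forall y \near (0 : 'rV[R]_n), y != 0 -> P (enorm y).
Proof.
rewrite near_withinE => H.
have C := @continuous_enorm R n 0; rewrite /continuous_at enorm0 in C.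
have {}H : \forall y \near (0 : 'rV[R]_n), 0 < enorm y -> P (enorm y) by exact: C H.
by near=> y; rewrite -enorm_gt0; near: y.
Unshelve. all: by end_near. Qed.

End Differentiation.

(** * The polar chart around a pole *)

(** The profile curve [(z, f)] of a smooth cap of revolution of radius [a], parametrized by the
    arc length from its pole, which lies at height [z0]. *)
Record polar_profile (R : realType) (a z0 : R) (f z : R -> R) : Prop := {
  pp_gt0 : 0 < a ;
  pp_df : forall s, 0 < s < a -> derivable f s 1 ;
  pp_dz : forall s, 0 < s < a -> derivable z s 1 ;
  pp_cf : forall s, 0 < s < a -> {for s, continuous (derive1 f)} ;
  pp_cz : forall s, 0 < s < a -> {for s, continuous (derive1 z)} ;
  pp_f_gt0 : forall s, 0 < s < a -> 0 < f s ;
  pp_arclength : forall s, 0 < s < a -> derive1 z s ^+ 2 + derive1 f s ^+ 2 = 1 ;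
  pp_f0 : f s @[s --> 0^'+] --> (0 : R) ;
  pp_z0 : z s @[s --> 0^'+] --> z0 ;
  pp_df0 : derive1 f s @[s --> 0^'+] --> (1 : R) ;
  pp_dz0 : derive1 z s @[s --> 0^'+] --> (0 : R)
}.

Section PolarChart.
Context {R : realType} {a z0 : R} {f z : R -> R}.
Hypothesis prof : polar_profile a z0 f z.
Variable d : nat.

(** The height and the ratio [f s / s], extended by continuity to the pole, so that
    one formula describes the chart on the whole ball. *)
Let h s := if s == 0 then z0 else z s.
Let g s := if s == 0 then 1 else f s / s.
Let dg s := (derive1 f s - g s) / s.

Definition polar_chart (x : 'rV[R]_d) : 'rV[R]_(1 + d) :=
  row_mx (const_mx (h (enorm x)) : 'rV[R]_1) (g (enorm x) *: x).

Definition polar_jacobian (x : 'rV[R]_d) : 'M[R]_(d, 1 + d) :=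
  if x == 0 then row_mx 0 1%:M else
  row_mx ((derive1 z (enorm x) / enorm x) *: x^T)
    ((g (enorm x))%:M + (dg (enorm x) / enorm x) *: (x^T *m x)).

Lemma polar_chart0 : polar_chart 0 = row_mx (const_mx z0) 0.
Proof. by rewrite /polar_chart enorm0 /h eqxx scaler0. Qed.

Lemma polar_chartE s (th : 'rV[R]_d) : 0 < s -> sphere th ->
  polar_chart (s *: th) = rot_coord z f s th.
Proof.
rewrite /sphere/= => s0 th1.
rewrite /polar_chart enormZ th1 mulr1 gtr0_norm// /h /g gt_eqF//.
by rewrite scalerA divfK ?gt_eqF.
Qed.

Lemma polar_decomposition (x : 'rV[R]_d) : x != 0 ->
  exists s th, [/\ 0 < s, s = enorm x, sphere th & x = s *: th].
Proof.
move=> x0; exists (enorm x), ((enorm x)^-1 *: x); split => //.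
- by rewrite enorm_gt0.
- exact: sphere_normalize.
- by rewrite scalerA mulfV ?scale1r// enorm_eq0.
Qed.

Lemma profile_slope s : 0 < s < a -> derive1 f s ^+ 2 <= 1.
Proof. by move=> /(pp_arclength prof) <-; rewrite lerDr sqr_ge0. Qed.

(** A curve of unit speed that starts on the axis is never farther from it than its
    arc length. *)
Lemma profile_le s : 0 < s < a -> f s <= s.
Proof.
move=> sa.
have B t : 0 < t < a -> `|derive1 f t - 0| <= 1.
  by move=> ta; rewrite subr0 -ler_sqr ?nnegrE// real_normK ?num_real// expr1n profile_slope.
have := mvt_at_right (pp_df prof) B (pp_f0 prof) sa.
by rewrite mul0r !subr0 mul1r; exact/le_trans/ler_norm.
Qed.

Lemma ratio_bounds s : 0 < s < a -> 0 < g s <= 1.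
Proof.
move=> /[dup] sa /andP[s0 _]; rewrite /g gt_eqF// divr_gt0 ?(pp_f_gt0 prof)//=.
by rewrite ler_pdivrMr// mul1r profile_le.
Qed.

Lemma near_small_slope e : 0 < e -> \forall s \near 0^'+,
  [/\ s < a, `|derive1 z s| <= e & `|derive1 f s - 1| <= e].
Proof.
move=> e0; near=> s; split; near: s.
- exact: (nbhs_right_lt (pp_gt0 prof)).
- have /cvgr0Pnorm_le := pp_dz0 prof; exact.
- have /cvgrPdist_le/(_ e e0) := pp_df0 prof.
  by apply: filterS => s; rewrite distrC.
Unshelve. all: by end_near. Qed.

(** Near the pole the profile agrees with the horizontal line up to an arbitrarily
    small relative error. *)
Lemma near_flat e : 0 < e -> \forall s \near 0^'+,
  [/\ `|h s - z0| <= e * s, `|g s - 1| <= e, `|derive1 z s| <= e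
    & `|derive1 f s - g s| <= e].
Proof.
move=> e0; have e2 : 0 < e / 2 by rewrite divr_gt0.
have := near_small_slope e2; rewrite near_withinE => /nbhs_ballP[b /= b0 bP].
have B t : 0 < t < b -> [/\ t < a, `|derive1 z t| <= e / 2 & `|derive1 f t - 1| <= e / 2].
  move=> /andP[t0 tb]; apply: bP => //.
  by rewrite /ball/= sub0r normrN gtr0_norm.
near=> s.
have s0 : 0 < s by near: s; exact: nbhs_right_gt.
have sb : 0 < s < b by rewrite s0/=; near: s; exact: nbhs_right_lt.
have dz t : 0 < t < b -> derivable z t 1.
  by move=> /[dup] /B[ta _ _] /andP[t0 _]; apply: (pp_dz prof); rewrite t0.
have df t : 0 < t < b -> derivable f t 1.
  by move=> /[dup] /B[ta _ _] /andP[t0 _]; apply: (pp_df prof); rewrite t0.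
have Bz t : 0 < t < b -> `|derive1 z t - 0| <= e / 2.
  by move=> /B[_ + _]; rewrite subr0.
have Bf t : 0 < t < b -> `|derive1 f t - 1| <= e / 2 by move=> /B[].
have hz := mvt_at_right dz Bz (pp_z0 prof) sb.
have hf := mvt_at_right df Bf (pp_f0 prof) sb.
have [_ z'e f'e] := B s sb.
have gE : `|g s - 1| <= e / 2.
  rewrite /g gt_eqF// -(@ler_pM2r _ s)// -[X in _ * X <= _](gtr0_norm s0) -normrM.
  by rewrite mulrBl divfK ?gt_eqF// -(subr0 (f s)).
have ee : e / 2 <= e by rewrite ler_pdivrMr// ler_peMr ?ler1n// ltW.
split.
- rewrite /h gt_eqF//; rewrite mul0r subr0 in hz.
  by apply: le_trans hz _; rewrite ler_wpM2r// ltW.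
- exact: le_trans ee.
- exact: le_trans ee.
- rewrite -(subrKA 1) (splitr e); apply: le_trans (ler_normD _ _) _.
  by apply: lerD => //; rewrite distrC.
Unshelve. all: by end_near. Qed.

Lemma is_derive_height s : 0 < s < a -> is_derive s 1 h (derive1 z s).
Proof.
move=> /[dup] sa /andP[s0 _].
apply: (@near_eq_is_derive _ _ _ z) => //.
  near=> t; rewrite /h gt_eqF//; near: t; exact: lt_nbhsr.
by rewrite derive1E; apply: derivableP; exact: (pp_dz prof).
Unshelve. all: by end_near. Qed.

Lemma is_derive_ratio s : 0 < s < a -> is_derive s 1 g (dg s).
Proof.
move=> /[dup] sa /andP[s0 _].
apply: (@near_eq_is_derive _ _ _ (fun t => f t * t^-1)) => //.
  near=> t; rewrite /g gt_eqF//; near: t; exact: lt_nbhsr.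
have df : is_derive s 1 f (derive1 f s).
  by rewrite derive1E; apply: derivableP; exact: (pp_df prof).
have s_neq0 : s != 0 by rewrite gt_eqF.
have dV : is_derive s 1 (fun t : R => t^-1) (- s ^- 2 *: (1 : R)).
  exact: (is_deriveV (f := id)).
apply: is_derive_eq; rewrite /dg /g gt_eqF// /GRing.scale/=; field.
exact: s_neq0.
Unshelve. all: by end_near. Qed.


Lemma polar_chart_coord0 x (j : 'I_1) : polar_chart x 0 (lshift d j) = h (enorm x).
Proof. by rewrite row_mxEl mxE. Qed.

Lemma polar_chart_coordS x j : polar_chart x 0 (rshift 1 j) = g (enorm x) * x 0 j.
Proof. by rewrite row_mxEr mxE. Qed.

Lemma is_diff_coord m (x : 'rV[R]_m) j :
  is_diff x (fun y : 'rV[R]_m => y 0 j) (fun v => v 0 j).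
Proof.
have lin : linear (fun v : 'rV[R]_m => v 0 j) by move=> c u v; rewrite !mxE.
pose L : {linear 'rV[R]_m -> R} := HB.pack (fun v : 'rV[R]_m => v 0 j)
  (GRing.isLinear.Build _ _ _ _ _ lin).
have cL : continuous L by exact: coord_continuous.
apply: (@DiffDef _ _ _ _ _ _ L); first exact: differentiable_coord.
by rewrite (diff_lin _ cL).
Qed.

Lemma is_diff_polar_chart x : x != 0 -> enorm x < a ->
  forall i, is_diff x (fun y => polar_chart y 0 i) (fun v => (v *m polar_jacobian x) 0 i).
Proof.
move=> x0 xa i.
have rx : 0 < enorm x < a by rewrite enorm_gt0 x0.
have r0 : enorm x != 0 by rewrite enorm_eq0.
rewrite /polar_jacobian (negbTE x0).
rewrite -(splitK i); case: (fintype.split i) => j /=.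
- have -> : (fun y => polar_chart y 0 (lshift d j)) = (fun y => h (enorm y)).
    by apply/funext => y; rewrite polar_chart_coord0.
  apply: is_diff_eq (is_diff_radial x0 (is_derive_height rx)) _.
  apply/funext => v; rewrite mul_mx_row row_mxEl -scalemxAr mxE ord1.
  have -> : (v *m x^T) 0 0 = dotp x v.
    by rewrite mxE; apply: eq_bigr => k _; rewrite mxE mulrC.
  by rewrite mulrAC mulrA.
- have -> : (fun y => polar_chart y 0 (rshift 1 j)) =
      (fun y => g (enorm y)) * (fun y : 'rV[R]_d => y 0 j).
    by apply/funext => y; rewrite polar_chart_coordS.
  have D := is_diff_radial x0 (is_derive_ratio rx).
  apply: is_diff_eq (is_diffM D (is_diff_coord x j)) _.
  apply/funext => v; rewrite mul_mx_row row_mxEr mulmxDr mul_mx_scalar -scalemxAr.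
  rewrite mulmxA.
  have -> : v *m x^T = (dotp x v)%:M.
    apply/matrixP => k l; rewrite !ord1 !mxE.
    by rewrite eqxx mulr1n; apply: eq_bigr => m _; rewrite mxE mulrC.
  rewrite mul_scalar_mx !mxE.
  transitivity (g (enorm x) * v 0 j + x 0 j * (dg (enorm x) * (dotp x v / enorm x))).
    by [].
  ring.
Qed.

(** The norm is not differentiable at the pole, where the first order expansion comes from
    the flatness of the profile instead of the chain rule. *)
Lemma polar_chart_diff x : enorm x < a ->
  differentiable polar_chart x /\ jacobian polar_chart x = polar_jacobian x.
Proof.
move=> xa; have [->|x0] := eqVneq x 0; last first.
  have D := is_diff_polar_chart x0 xa.
  have dX : differentiable polar_chart x by apply: differentiable_rV => j; exact: (@ex_diff _ _ _ _ _ _ _ (D j)).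
  split => //; apply/matrixP => i j.
  by rewrite jacobianE// (@diff_val _ _ _ _ _ _ _ (D j)) -rowE mxE.
pose J : {linear 'rV[R]_d -> 'rV[R]_(1 + d)} := mulmxr (row_mx 0 1%:M).
have cJ : continuous J.
  apply: continuous_rV => i; rewrite -(splitK i); case: (fintype.split i) => j /=.
  - have -> : (fun v : 'rV[R]_d => (v *m row_mx 0 1%:M : 'rV[R]_(1 + d)) 0 (lshift d j)) = cst 0.
      by apply/funext => v; rewrite mul_mx_row row_mxEl mulmx0 mxE.
    exact: cst_continuous.
  - have -> : (fun v : 'rV[R]_d => (v *m row_mx 0 1%:M : 'rV[R]_(1 + d)) 0 (rshift 1 j)) =
        (fun v => v 0 j).
      by apply/funext => v; rewrite mul_mx_row row_mxEr mulmx1.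
    exact: coord_continuous.
suff D : is_diff (0 : 'rV[R]_d) polar_chart J.
  split; first exact: (@ex_diff _ _ _ _ _ _ _ D).
  apply/matrixP => i j; rewrite /jacobian mxE (@diff_val _ _ _ _ _ _ _ D).
  by rewrite /polar_jacobian eqxx /= -rowE mxE.
apply: is_diff_eps => // e e0.
have e1 : 0 < e / (d%:R + 1) by rewrite divr_gt0// ltr_wpDl.
have ee : e / (d%:R + 1) <= e.
  rewrite ler_pdivrMr ?ltr_wpDl//; apply: ler_peMr; first exact: ltW.
  by rewrite lerDr.
have N := near_enorm d (near_flat e1).
near=> v; rewrite addr0 polar_chart0.
have [->|v0] := eqVneq v 0.
  by rewrite polar_chart0 linear0 subr0 subrr !normr0 mulr0.
have [hv gv _ _] : [/\ `|h (enorm v) - z0| <= e / (d%:R + 1) * enorm v,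
    `|g (enorm v) - 1| <= e / (d%:R + 1), `|derive1 z (enorm v)| <= e / (d%:R + 1)
    & `|derive1 f (enorm v) - g (enorm v)| <= e / (d%:R + 1)].
  by move: v0; near: v.
apply: rV_norm_le => [|i]; first by rewrite mulr_ge0// ltW.
have E (u t w : 'rV[R]_(1 + d)) k : (u - t - w) 0 k = u 0 k - t 0 k - w 0 k.
  by rewrite !mxE.
rewrite E -(splitK i); case: (fintype.split i) => j /=.
- rewrite polar_chart_coord0 mul_mx_row mulmx0 !row_mxEl !mxE subr0.
  apply: le_trans hv _.
  apply: le_trans (_ : e / (d%:R + 1) * (d%:R * `|v|) <= _).
    by apply: ler_wpM2l; [exact: ltW|exact: enorm_le_norm].
  rewrite mulrA ler_wpM2r// mulrAC -mulrA; apply: ler_piMr; first exact: ltW.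
  by rewrite ler_pdivrMr ?ltr_wpDl// mul1r lerDl.
- rewrite polar_chart_coordS mul_mx_row mulmx1 !row_mxEr !mxE subr0 -{2}(mul1r (v 0 j)) -mulrBl normrM.
  by apply: ler_pM => //; [exact: le_trans ee|exact: coord_le_norm].
Unshelve. all: by end_near. Qed.

End PolarChart.

Section PolarVolume.
Context {R : realType} {a z0 : R} {f z : R -> R}.
Hypothesis prof : polar_profile a z0 f z.
Variable d : nat.
Local Notation X := (@polar_chart R z0 f z d).
Local Notation J := (@polar_jacobian R f z d).

Lemma mulmx_tr_dotp (x : 'rV[R]_d) : x *m x^T = (enorm x ^+ 2)%:M.
Proof. by rewrite mulmx_trE sqr_enorm. Qed.

(** In the radial direction the chart is isometric, in the orthogonal directions
    it is a similarity of ratio [f r / r]. *)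
Lemma gram_polar x : enorm x < a -> exists2 c, 0 < c <= 1 &
  J x *m (J x)^T = (c ^+ 2)%:M + ((1 - c ^+ 2) / enorm x ^+ 2) *: (x^T *m x).
Proof.
move=> xa; rewrite /polar_jacobian; have [->|x0] := eqVneq x 0.
  exists 1; first by rewrite ltr01 lexx.
  rewrite tr_row_mx mul_row_col trmx0 mul0mx add0r trmx1 mulmx1.
  by rewrite expr1n subrr mul0r scale0r addr0.
have rx : 0 < enorm x < a by rewrite enorm_gt0 x0.
have := ratio_bounds prof rx; have /andP[r_gt0 _] := rx.
have := pp_arclength prof rx.
rewrite gt_eqF//; have := mulmx_tr_dotp x.
move: (derive1 z _) (derive1 f _) (f _ / _) r_gt0 => dz df c.
move: (enorm x) => r r0 xx arc cb; exists c => //.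
have r_neq0 : r != 0 by rewrite gt_eqF.
rewrite tr_row_mx mul_row_col !linearZ/= linearD/= linearZ/= trmx_mul trmxK tr_scalar_mx.
rewrite mulmxDl !mulmxDr -!scalemxAl -!scalemxAr.
have -> : x^T *m x *m (x^T *m x) = (r ^+ 2) *: (x^T *m x).
  by rewrite -mulmxA (mulmxA x) xx mul_scalar_mx -scalemxAr.
rewrite -scalar_mxM mul_scalar_mx mul_mx_scalar !scalerA -!scalerDl.
rewrite addrCA -!addrA; congr (_ + _); rewrite -!scalerDl; congr (_ *: _).
have E : dz ^+ 2 = 1 - df ^+ 2 by rewrite -arc addrK.
rewrite (_ : c *: - c = - c ^+ 2); last by rewrite /GRing.scale/= mulrN expr2.
transitivity ((dz ^+ 2 + 2 * c * (df - c) + (df - c) ^+ 2) / r ^+ 2); first by field.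
by rewrite E; congr (_ / _); ring.
Qed.

(** The determinant is the power [2 * (d - 1)] of the ratio of the similarity, and this
    ratio is at most [1] by [profile_le]. *)
Lemma det_gram_polar x : (0 < d)%N -> enorm x < a ->
  0 < \det (J x *m (J x)^T) <= 1.
Proof.
move=> d0 xa; have [c /andP[c0 c1] ->] := gram_polar xa.
have c2 : 0 < c ^+ 2 by rewrite exprn_gt0.
have c21 : c ^+ 2 <= 1 by rewrite expr_le1// ltW.
rewrite det_scalar_rank1 ?gt_eqF// mulmx_tr_dotp mxE eqxx mulr1n.
have [->|x0] := eqVneq x 0.
  rewrite enorm0 expr0n mulr0 addr0 mulr1 exprn_gt0//=.
  by rewrite exprn_ile1// ltW.
have r2 : enorm x ^+ 2 != 0 by rewrite sqrf_eq0 enorm_eq0.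
have -> : 1 + (1 - c ^+ 2) / enorm x ^+ 2 / c ^+ 2 * enorm x ^+ 2 = (c ^+ 2)^-1.
  by field; rewrite -enorm_eq0 in x0; rewrite x0 gt_eqF.
case: d d0 => // d' _; rewrite exprSr mulfK ?gt_eqF// exprn_gt0//=.
by rewrite exprn_ile1// ltW.
Qed.

Lemma polar_jacobian_continuous x : enorm x < a ->
  J y @[y --> x] --> J x.
Proof.
move=> xa; have [->|x0] := eqVneq x 0.
  apply: cvg_at_dist => e e0.
  have e2 : 0 < e / 2 by rewrite divr_gt0.
  have N := near_enorm d (near_flat prof e2).
  near=> y; have [->|y0] := eqVneq y 0; first by rewrite subrr normr0 ltW.
  have [_ gy zy fy] : [/\ `|(if enorm y == 0 then z0 else z (enorm y)) - z0| <= e / 2 * enorm y,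
      `|(if enorm y == 0 then 1 else f (enorm y) / enorm y) - 1| <= e / 2,
      `|derive1 z (enorm y)| <= e / 2
      & `|derive1 f (enorm y) - (if enorm y == 0 then 1 else f (enorm y) / enorm y)| <= e / 2].
    by move: y0; near: y.
  have r0 : 0 < enorm y by rewrite enorm_gt0.
  have ratio k : `|(enorm y)^-1 * y 0 k| <= 1.
    by rewrite normrM normfV (gtr0_norm r0) ler_pdivrMl// mulr1 coord_le_enorm.
  rewrite [leLHS]/Num.Def.normr/= mx_normrE; apply: bigmax_le; first exact: ltW.
  move=> [i j] _ /=.
  have E (M P : 'M[R]_(d, 1 + d)) k l : (M - P) k l = M k l - P k l by rewrite !mxE.
  rewrite E /polar_jacobian eqxx (negbTE y0) -(splitK j) (splitr e).
  case: (fintype.split j) => k /=.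
  - rewrite !row_mxEl !mxE sub0r normrN -mulrA normrM -[leRHS]mulr1.
    apply: ler_pM; rewrite ?normr_ge0//; last by rewrite (ord1 k) ratio.
    apply: le_trans zy _; rewrite lerDl; exact: ltW.
  - rewrite !row_mxEr !mxE big_ord1 !mxE.
    move: gy fy; set g := (if _ then 1 else _); set df := derive1 f _ => gy fy.
    have -> : (i == k)%:R - (g *+ (i == k) + (df - g) / enorm y / enorm y * (y 0 i * y 0 k)) =
       (1 - g) * (i == k)%:R -
       (df - g) * (((enorm y)^-1 * y 0 i) * ((enorm y)^-1 * y 0 k)).
      by rewrite -mulr_natr; ring.
    apply: le_trans (ler_normB _ _) _; apply: lerD.
      rewrite normrM -[leRHS]mulr1; apply: ler_pM => //; first by rewrite distrC.
      by case: (i == k); rewrite ?normr1 ?normr0.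
    rewrite normrM -[leRHS]mulr1; apply: ler_pM => //.
    by rewrite normrM -[leRHS]mulr1; apply: ler_pM.
have rx : 0 < enorm x < a by rewrite enorm_gt0 x0.
have rn : enorm y @[y --> x] --> enorm x by exact: continuous_enorm.
have r0 : enorm x != 0 by rewrite enorm_eq0.
pose J' (y : 'rV[R]_d) : 'M[R]_(d, 1 + d) := row_mx ((derive1 z (enorm y) / enorm y) *: y^T)
   ((f (enorm y) / enorm y)%:M +
     (((derive1 f (enorm y) - f (enorm y) / enorm y) / enorm y) / enorm y) *: (y^T *m y)).
have JJ' y : y != 0 -> J y = J' y.
  by move=> y0; rewrite /polar_jacobian /J' (negbTE y0) enorm_eq0 (negbTE y0).
suff C : J' y @[y --> x] --> J' x.
  have P : \forall y \near x, 0 < enorm y.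
    by apply: (cvgr_gt _ rn); rewrite enorm_gt0.
  have E : \forall y \near x, J' y = J y.
    by near=> y; rewrite JJ'// -enorm_gt0; near: y.
  by rewrite JJ' //; apply: (cvg_trans (near_eq_cvg E)).
have cf : f (enorm y) @[y --> x] --> f (enorm x).
  have cf0 : {for enorm x, continuous f}.
    by apply: differentiable_continuous; exact/derivable1_diffP/(pp_df prof).
  exact: (@cvg_comp _ _ _ (@enorm R d) f _ _ _ rn cf0).
have cdf : derive1 f (enorm y) @[y --> x] --> derive1 f (enorm x).
  exact: (@cvg_comp _ _ _ (@enorm R d) (derive1 f) _ _ _ rn (pp_cf prof rx)).
have cdz : derive1 z (enorm y) @[y --> x] --> derive1 z (enorm x).
  exact: (@cvg_comp _ _ _ (@enorm R d) (derive1 z) _ _ _ rn (pp_cz prof rx)).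
have cr : (enorm y)^-1 @[y --> x] --> (enorm x)^-1.
  exact: (cvgV r0 rn).
have cx k : (y : 'rV[R]_d) 0 k @[y --> x] --> x 0 k by exact: coord_continuous.
have cg : f (enorm y) / enorm y @[y --> x] --> f (enorm x) / enorm x by exact: (cvgM cf cr).
have cdg : (derive1 f (enorm y) - f (enorm y) / enorm y) / enorm y / enorm y @[y --> x] -->
    (derive1 f (enorm x) - f (enorm x) / enorm x) / enorm x / enorm x.
  by apply: (cvgM _ cr); apply: (cvgM _ cr); exact: (cvgB cdf cg).
apply: cvg_at_mx => i j; rewrite -(splitK j); case: (fintype.split j) => k /=.
- have E (y : 'rV[R]_d) : J' y i (lshift d k) = derive1 z (enorm y) / enorm y * y 0 i.
    by rewrite (ord1 k) row_mxEl !mxE.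
  under eq_cvg do rewrite E; rewrite E; exact: (cvgM (cvgM cdz cr) (cx i)).
- have E (y : 'rV[R]_d) : J' y i (rshift 1 k) = f (enorm y) / enorm y * (i == k)%:R +
      (derive1 f (enorm y) - f (enorm y) / enorm y) / enorm y / enorm y * (y 0 i * y 0 k).
    by rewrite row_mxEr !mxE big_ord1 !mxE mulr_natr.
  under eq_cvg do rewrite E; rewrite E.
  exact: (cvgD (cvgM cg (cvg_cst _)) (cvgM cdg (cvgM (cx i) (cx k)))).
Unshelve. all: by end_near. Qed.

End PolarVolume.

Section CapVolume.
Context {R : realType} {a z0 : R} {f z : R -> R} {d : nat}.
Hypothesis prof : polar_profile a z0 f z.
Variable Sigma : set 'rV[R]_(1 + d).
Hypothesis in_Sigma : forall s (th : 'rV[R]_d), 0 < s < a -> sphere th ->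
  Sigma (rot_coord z f s th).
Hypothesis pole_in_Sigma : Sigma (row_mx (const_mx z0) 0).
Hypothesis rot_inj : forall s1 s2 (th1 th2 : 'rV[R]_d), 0 < s1 < a -> 0 < s2 < a ->
  sphere th1 -> sphere th2 -> rot_coord z f s1 th1 = rot_coord z f s2 th2 ->
  s1 = s2 /\ th1 = th2.
Local Notation X := (@polar_chart R z0 f z d).
Local Notation J := (@polar_jacobian R f z d).
Let U := [set x : 'rV[R]_d | enorm x < a].

Definition polar_cap : set 'rV[R]_(1 + d) := X @` U.

Let open_U : open U.
Proof.
apply: (@open_comp _ _ (@enorm R d) [set t | t < a]); last exact: open_lt.
by move=> x _; exact: continuous_enorm.
Qed.

Let polar_chart_inj : {in U &, injective X}.
Proof.
have pole_ne s (th : 'rV[R]_d) : 0 < s < a -> sphere th ->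
    rot_coord z f s th != row_mx (const_mx z0) 0.
  move=> sa th1; apply/eqP => /eq_row_mx[_ /eqP]; rewrite scaler_eq0.
  rewrite gt_eqF ?(pp_f_gt0 prof)//= -enorm_eq0.
  by rewrite (th1 : enorm th = 1) oner_eq0.
move=> x y /set_mem xU /set_mem yU.
have [->|x0] := eqVneq x 0; have [->|y0] := eqVneq y 0 => //.
- have [s [th [s0 sE th1 yE]]] := polar_decomposition y0.
  rewrite yE polar_chart0 polar_chartE// => /esym/eqP.
  by rewrite (negbTE (pole_ne _ _ _ th1))// s0 sE.
- have [s [th [s0 sE th1 xE]]] := polar_decomposition x0.
  rewrite xE polar_chart0 polar_chartE// => /eqP.
  by rewrite (negbTE (pole_ne _ _ _ th1))// s0 sE.
- have [s [th [s0 sE th1 xE]]] := polar_decomposition x0.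
  have [t [om [t0 tE om1 yE]]] := polar_decomposition y0.
  rewrite xE yE !polar_chartE// => E.
  have sa : 0 < s < a by rewrite s0 sE.
  have ta : 0 < t < a by rewrite t0 tE.
  by have [-> ->] := rot_inj sa ta th1 om1 E.
Qed.

Lemma polar_cap_local_param : (0 < d)%N -> local_param Sigma U X.
Proof.
move=> d0; split => //.
- move=> x xU; have [dX _] := polar_chart_diff prof xU; split => //.
  have E : \forall y \near x, J y = jacobian X y.
    near=> y; have yU : enorm y < a by near: y; exact: open_nbhs_nbhs.
    by have [_ ->] := polar_chart_diff prof yU.
  have [_ JX] := polar_chart_diff prof xU.
  have C := polar_jacobian_continuous prof xU.
  rewrite -JX in C.
  exact: (cvg_trans (near_eq_cvg E) C).
- move=> x xU; have [_ ->] := polar_chart_diff prof xU.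
  have /andP[D _] := det_gram_polar prof d0 xU.
  rewrite -row_leq_rank; apply: leq_trans (mxrankM_maxl _ (J x)^T).
  by rewrite mxrank_unit// unitmxE unitfE gt_eqF.
- move=> _ [x xU <-]; have [->|x0] := eqVneq x 0; first by rewrite polar_chart0.
  have [s [th [s0 sE th1 xE]]] := polar_decomposition x0.
  by rewrite xE polar_chartE//; apply: in_Sigma => //; rewrite s0 sE.
Unshelve. all: by end_near. Qed.

(** The chart does not increase volumes, since the determinant of its Gram matrix
    is at most [1]. *)
Lemma polar_cap_volume (vol : {measure set (borel_rV R (1 + d)) -> \bar R}) :
  (0 < d)%N -> riemannian_volume d Sigma vol ->
  (vol polar_cap <= (a ^+ d)%:E * ball_volume R d)%E.
Proof.
move=> d0 hvol; rewrite (hvol _ _ (polar_cap_local_param d0)).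
rewrite -(ball_volume_scale d (pp_gt0 prof)).
apply: le_rV_integral => x; rewrite lee_fin; first by rewrite mulr_ge0// sqrtr_ge0.
have [xU|xU] := pselect (U x); last first.
  by rewrite indicE memNset// mul0r.
rewrite !indicE !mem_set//=; last exact: ltW.
rewrite mul1r /gram; have [_ ->] := polar_chart_diff prof xU.
have /andP[D0 D1] := det_gram_polar prof d0 xU.
by rewrite -sqrtr1 ler_sqrt.
Qed.

Lemma compact_closed_ball n (b : R) : compact [set x : 'rV[R]_n | enorm x <= b].
Proof.
apply: bounded_closed_compact.
  exists b; split; first exact: num_real.
  by move=> c bc x /= xb; apply: le_trans (norm_le_enorm x) _; apply: le_trans xb (ltW bc).
apply: (@closed_comp _ _ (@enorm R n) [set t | t <= b]); last exact: closed_le.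
by move=> x _; exact: continuous_enorm.
Qed.

Lemma closed_borel_measurable n (A : set 'rV[R]_n) : closed A ->
  measurable (A : set (borel_rV R n)).
Proof.
move=> cA; rewrite -(setCK A); apply: measurableC.
by apply: sub_sigma_algebra; exact: closed_openC.
Qed.

(** The images of smaller closed balls are compact and exhaust the cap. *)
Lemma measurable_polar_cap : measurable (polar_cap : set (borel_rV R (1 + d))).
Proof.
have -> : polar_cap = \bigcup_n (X @` [set x | enorm x <= a - n.+1%:R^-1]).
  rewrite -image_bigcup; congr (_ @` _); apply/seteqP; split => x /=.
    rewrite /U/= -subr_gt0 => /ltr_add_invr[n]; rewrite add0r => an.
    by exists n => //=; rewrite lerBrDr -lerBrDl ltW.
  by move=> [n _ /= xn]; apply: le_lt_trans xn _; rewrite ltrBlDr ltrDl invr_gt0.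
apply: bigcup_measurable => n _; apply: closed_borel_measurable.
apply: compact_closed; first exact: norm_hausdorff.
apply: continuous_compact; last exact: compact_closed_ball.
apply: continuous_in_subspaceT => x /set_mem /= xn.
apply: differentiable_continuous.
have xa : enorm x < a by apply: le_lt_trans xn _; rewrite ltrBlDr ltrDl invr_gt0.
by have [] := polar_chart_diff prof xa.
Qed.

End CapVolume.

(** * Smoothly embedded spheres *)

(** Local form of the continuity of the inverse of a continuous injection on a compact set: the
    image of the points outside [N] is compact, hence closed. *)
Lemma compact_near_preimage (T U : topologicalType) (K : set T) (f : T -> U) (x0 : T)
    (N : set T) : hausdorff_space U -> compact K -> {within K, continuous f} ->
  (forall x, K x -> f x = f x0 -> x = x0) -> nbhs x0 N ->
  \forall y \near f x0, forall x, K x -> f x = y -> N x.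
Proof.
move=> hU cK cf inj_x0; rewrite nbhsE => -[B [oB Bx0] BN].
have cKB : compact (K `&` ~` B) by apply: compact_closedI => //; exact: open_closedC.
have cim : closed (f @` (K `&` ~` B)).
  apply: compact_closed => //; apply: continuous_compact => //.
  by apply: continuous_subspaceW cf => x [].
have nb : nbhs (f x0) (~` (f @` (K `&` ~` B))).
  apply: open_nbhs_nbhs; split; first exact: closed_openC.
  by move=> [x [Kx nBx] fx]; apply: nBx; rewrite (inj_x0 x Kx fx).
apply: filterS nb => y ny x Kx fxy; apply: BN.
by apply: contrapT => nBx; apply: ny; exists x.
Qed.

Section Derivatives.
Context {R : realType}.

Lemma is_derive_comp_diff (V W : normedModType R) (c : R -> V) (t : R) (c' : V)
    (F : V -> W) : is_derive t 1 c c' -> differentiable F (c t) ->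
  is_derive t 1 (F \o c) ('d F (c t) c').
Proof.
move=> dc dF.
have c1 : derivable c t 1 by exact: ex_derive.
have dct : differentiable c t by exact/derivable1_diffP.
have dFc : differentiable (F \o c) t by exact: differentiable_comp.
apply: DeriveDef; first exact/derivable1_diffP.
rewrite deriveE// diff_comp//=; congr ('d F (c t) _).
by rewrite -deriveE// derive_val.
Qed.

Lemma is_derive_rV n (c : R -> 'rV[R]_n) (t : R) (w : 'rV[R]_n) :
  is_derive t 1 c w <-> forall j, is_derive t 1 (fun s => c s 0 j) (w 0 j).
Proof.
split=> [D j|D].
  have D1 : derivable c t 1 by exact: (@ex_derive _ _ _ _ _ _ _ D).
  apply: DeriveDef; first exact: (derivable_mxP c t 1).1.
  have := derive_mx D1; rewrite (@derive_val _ _ _ _ _ _ _ D).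
  by move=> /matrixP/(_ 0 j); rewrite [RHS]mxE.
have D1 : derivable c t 1.
  by apply/derivable_mxP => i j; rewrite ord1; exact: (@ex_derive _ _ _ _ _ _ _ (D j)).
apply: DeriveDef => //; rewrite derive_mx//.
by apply/rowP => j; rewrite mxE; exact: (@derive_val _ _ _ _ _ _ _ (D j)).
Qed.

Lemma mulmx_norm_le n m (v : 'rV[R]_n) (A : 'M[R]_(n, m)) :
  `|v *m A| <= n%:R * `|v| * `|A|.
Proof.
apply: rV_norm_le => [|j]; first by rewrite !mulr_ge0.
rewrite mxE; apply: le_trans (ler_norm_sum _ _ _) _.
rewrite -mulrA -[X in X%:R]card_ord -sum1_card natr_sum mulr_suml.
apply: ler_sum => i _; rewrite mul1r normrM ler_pM ?coord_le_norm//.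
by rewrite [leRHS]/Num.Def.normr/= mx_normrE (le_bigmax _ _ (i, j)).
Qed.

(** A map with continuous differential is strictly differentiable: the mean value theorem is
    applied to each coordinate along the segment from [y] to [x]. *)
Lemma strict_diff n m (F : 'rV[R]_n -> 'rV[R]_m) (x0 : 'rV[R]_n) :
  (forall x, differentiable F x) -> (forall v, continuous (fun x => 'D_v F x)) ->
  forall e, 0 < e -> exists2 r, 0 < r & forall x y, `|x - x0| < r -> `|y - x0| < r ->
    `|F x - F y - (x - y) *m jacobian F x0| <= e * `|x - y|.
Proof.
move=> dF cF e e0.
have e1 : 0 < e / (n%:R + 1) by rewrite divr_gt0// ltr_wpDl.
have cJ : jacobian F y @[y --> x0] --> jacobian F x0.
  apply: cvg_at_mx => i j.
  have E y : jacobian F y i j = ('D_(delta_mx 0 i) F y) 0 j.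
    by rewrite deriveEjacobian// -rowE [RHS]mxE.
  under eq_cvg do rewrite E; rewrite E.
  exact: (@cvg_coord _ _ _ (nbhs x0) _ (fun y => 'D_(delta_mx 0 i) F y) _ j (cF _ x0)).
have := near_at_dist cJ e1.
move=> /nbhs_ballP[r /= r0 rJ]; exists r => // x y xr yr.
apply: rV_norm_le => [|j]; first by rewrite mulr_ge0// ltW.
pose c (t : R) : 'rV[R]_n := y + t *: (x - y).
have dc (t : R) : is_derive t 1 c (x - y).
  have D1 : is_derive t 1 (fun=> y : 'rV[R]_n) 0 by exact: is_derive_cst.
  have D2 : is_derive t 1 (fun s : R => s *: (x - y)) (x - y).
    apply: DeriveDef; first by apply/derivable1_diffP.
    by rewrite deriveE// diff_val scale1r.
  by have := is_deriveD D1 D2; rewrite add0r.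
pose phi (t : R) : R := F (c t) 0 j.
have dphi (t : R) : is_derive t 1 phi (((x - y) *m jacobian F (c t)) 0 j).
  have D := is_derive_comp_diff (dc t) (dF (c t)).
  have := (is_derive_rV _ _ _).1 D j.
  by rewrite -deriveE// deriveEjacobian.
have cphi : {within `[0, 1], continuous phi}.
  by apply: derivable_within_continuous => t _; exact: (@ex_derive _ _ _ _ _ _ _ (dphi t)).
have [t t01] := MVT ltr01 (fun t _ => dphi t) cphi.
rewrite subr0 mulr1 /phi /c scale1r scale0r addr0 (addrC y) subrK => E.
have -> : (F x - F y - (x - y) *m jacobian F x0) 0 j =
    ((x - y) *m (jacobian F (y + t *: (x - y)) - jacobian F x0)) 0 j.
  have Eb (u v : 'rV[R]_m) : (u - v) 0 j = u 0 j - v 0 j by rewrite !mxE.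
  by rewrite mulmxBr !Eb E.
apply: le_trans (coord_le_norm _ _) _; apply: le_trans (mulmx_norm_le _ _) _.
apply: (@le_trans _ _ (n%:R * `|x - y| * (e / (n%:R + 1)))).
  apply: ler_wpM2l; first by rewrite mulr_ge0.
  rewrite distrC; apply: rJ; rewrite -ball_normE/= distrC.
  move: t01; rewrite in_itv/= => /andP[t0 t1].
  have -> : y + t *: (x - y) - x0 = (1 - t) *: (y - x0) + t *: (x - x0).
    by apply/rowP => k; rewrite !mxE; ring.
  apply: le_lt_trans (ler_normD _ _) _; rewrite !normrZ !gtr0_norm ?subr_gt0//.
  have -> : r = (1 - t) * r + t * r by ring.
  by apply: ltrD; rewrite ltr_pM2l// subr_gt0.
rewrite mulrAC; apply: ler_wpM2r => //.
rewrite mulrCA; apply: ler_piMr; first exact: ltW.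
by rewrite ler_pdivrMr ?ltr_wpDl// mul1r lerDl.
Qed.

End Derivatives.

Section EmbeddedSphere.
Context {R : realType} {d : nat}.
Local Notation n := (1 + d)%N.

Lemma compact_sphere m : compact (@sphere R m).
Proof.
apply: (@subclosed_compact _ _ [set x : 'rV[R]_m | enorm x <= 1]).
- apply: (@closed_comp _ _ (@enorm R m) [set 1]); last exact: closed_eq.
  by move=> x _; exact: continuous_enorm.
- exact: compact_closed_ball.
- by move=> x; rewrite /sphere/= => ->.
Qed.

(** Linear algebra of the tangent space: as the differential [J] is only injective on the orthogonal
    of [x0], it is modified in the direction of [x0], where it takes as value a normal [nu] to
    the image of that orthogonal; the resulting map [v *m M] is invertible. *)
Lemma tangent_normal (x0 : 'rV[R]_n) (J : 'M[R]_n) : dotp x0 x0 = 1 ->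
  (forall v, dotp x0 v = 0 -> v *m J = 0 -> v = 0) ->
  exists nu : 'rV[R]_n, exists M : 'M[R]_n,
   [/\ nu != 0, M \in unitmx,
      forall v, dotp (v *m M) nu = dotp v x0 * dotp nu nu &
      forall v, v *m M = v *m J + dotp v x0 *: (nu - x0 *m J)].
Proof.
move=> x01 Jinj.
pose P := J - x0^T *m x0 *m J.
have PE v : v *m P = v *m J - dotp v x0 *: (x0 *m J).
  by rewrite mulmxBr !mulmxA mulmx_trE mul_scalar_mx -scalemxAl.
have x0P : x0 *m P = 0 by rewrite PE x01 scale1r subrr.
have x0_neq0 : x0 != 0.
  by apply/eqP => x00; move: x01; rewrite x00 dotp0l => /eqP; rewrite eq_sym oner_eq0.
have /det0P[nu nu0 nuP] : \det P^T == 0.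
  by rewrite det_tr; apply/det0P; exists x0.
have Pnu v : dotp (v *m P) nu = 0.
  have : (v *m P) *m nu^T = 0 by rewrite -mulmxA -[P]trmxK -trmx_mul nuP trmx0 mulmx0.
  by rewrite mulmx_trE => /matrixP/(_ 0 0); rewrite !mxE eqxx mulr1n.
pose M := P + x0^T *m nu.
have ME v : v *m M = v *m P + dotp v x0 *: nu.
  by rewrite mulmxDr mulmxA mulmx_trE mul_scalar_mx.
have Mnu v : dotp (v *m M) nu = dotp v x0 * dotp nu nu.
  by rewrite ME dotpDl dotpZl Pnu add0r.
exists nu, M; split => //; last first.
  by move=> v; rewrite ME PE scalerBr -addrA [- _ + _]addrC.
rewrite unitmxE unitfE; apply/det0P => -[v v0 vM].
have vx0 : dotp v x0 = 0.
  have := Mnu v; rewrite vM dotp0l => /esym/eqP; rewrite mulf_eq0.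
  by rewrite dotp_eq0 (negbTE nu0) orbF => /eqP.
move/eqP: v0; apply; apply: Jinj; first by rewrite dotpC.
by move: vM; rewrite ME PE vx0 !scale0r subr0 addr0.
Qed.

(** A rational parametrization of the circle of the sphere tangent to [v] at [x0]. *)
Lemma sphere_curve m (x0 v : 'rV[R]_m) : dotp x0 x0 = 1 -> dotp v x0 = 0 ->
  exists c : R -> 'rV[R]_m,
    [/\ c 0 = x0, forall t, sphere (c t) & is_derive (0 : R) 1 c v].
Proof.
move=> x01 vx0; pose k := dotp v v / 4.
have k0 : 0 <= k by rewrite divr_ge0 ?dotp_ge0.
have D0 (t : R) : 1 + k * t ^+ 2 != 0.
  by rewrite gt_eqF// ltr_pwDl// mulr_ge0// sqr_ge0.
exists (fun t : R => (1 + k * t ^+ 2)^-1 *: ((1 - k * t ^+ 2) *: x0 + t *: v)); split.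
- by rewrite expr0n mulr0 subr0 addr0 invr1 !scale1r scale0r addr0.
- move=> t; apply/sphere_dotp.
  rewrite !(dotpZl, dotpZr, dotpDl, dotpDr) x01 vx0 (dotpC x0) vx0.
  have -> : dotp v v = 4 * k by rewrite /k mulrC divfK.
  by field; exact: D0.
- have dj j : is_derive (0 : R) 1 (fun t : R => ((1 + k * t ^+ 2)^-1 *:
      ((1 - k * t ^+ 2) *: x0 + t *: v)) 0 j) (v 0 j).
    have -> : (fun t : R => ((1 + k * t ^+ 2)^-1 *: ((1 - k * t ^+ 2) *: x0 + t *: v)) 0 j) =
       (fun t : R => (1 + k * t ^+ 2)^-1 * ((1 - k * t ^+ 2) * x0 0 j + t * v 0 j)).
      by apply/funext => t; rewrite !mxE.
    have d1 : is_derive (0 : R) 1 (fun t : R => 1 + k * t ^+ 2) 0.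
      apply: is_derive_eq; rewrite /GRing.scale/=; ring.
    have D00 : 1 + k * (0 : R) ^+ 2 != 0 by exact: D0.
    have d2 : is_derive (0 : R) 1 (fun t : R => (1 + k * t ^+ 2)^-1)
        (- (1 + k * (0 : R) ^+ 2) ^- 2 *: 0).
      exact: (is_deriveV (f := fun t : R => 1 + k * t ^+ 2)).
    have d3 : is_derive (0 : R) 1 (fun t : R => (1 - k * t ^+ 2) * x0 0 j + t * v 0 j) (v 0 j).
      apply: is_derive_eq; rewrite /GRing.scale/=; ring.
    apply: (is_derive_eq (is_deriveM d2 d3)).
    rewrite expr0n mulr0 subr0 addr0 invr1 scaler0 scaler0 addr0.
    by rewrite /GRing.scale/= mul1r.
  exact/is_derive_rV.
Qed.

Lemma embedded_sphere_compact (Sigma : set 'rV[R]_n) :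
  embedded_sphere Sigma -> compact Sigma.
Proof.
move=> [F [CF _ _ ->]]; apply: continuous_compact; last exact: compact_sphere.
by apply: continuous_subspaceT; have := CF 0%N.
Qed.

(** Chords of the round sphere near [x0] are tangent to it, and mapped linearly by [F], up to small
    relative errors; so chords of [Sigma] near [q] are almost orthogonal to the normal [nu].
    Conversely, tangent vectors are velocities of images of curves of the round
    sphere. *)
Lemma embedded_sphere_normal (Sigma : set 'rV[R]_n) (q : 'rV[R]_n) :
  embedded_sphere Sigma -> Sigma q ->
  exists nu : 'rV[R]_n, [/\ nu != 0,
    forall e, 0 < e -> exists2 r, 0 < r & forall x y, Sigma x -> Sigma y ->
      `|x - q| < r -> `|y - q| < r -> `|dotp nu (x - y)| <= e * `|x - y| &
    forall w, dotp nu w = 0 -> exists c : R -> 'rV[R]_n,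
      [/\ c 0 = q, forall t, Sigma (c t) & is_derive (0 : R) 1 c w]].
Proof.
move=> [F [CF injF immF ->]] [x0 x0S <-].
have dF x : differentiable F x by have [] := CF 1%N.
have cF v : continuous (fun x => 'D_v F x) by have [_] := CF 1%N; exact.
have x01 : dotp x0 x0 = 1 by exact/sphere_dotp.
have Jinj v : dotp x0 v = 0 -> v *m jacobian F x0 = 0 -> v = 0.
  by move=> x0v vJ; apply: (immF x0) => //; rewrite deriveEjacobian.
have [nu [M [nu0 uM Mnu ME]]] := tangent_normal x01 Jinj.
exists nu; split => //; last first.
  move=> w nuw; pose v := w *m invmx M.
  have vM : v *m M = w by rewrite mulmxKV.
  have vx0 : dotp v x0 = 0.
    have := Mnu v; rewrite vM dotpC nuw => /esym/eqP.
    by rewrite mulf_eq0 dotp_eq0 (negbTE nu0) orbF => /eqP.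
  have [c [c0 cS dc]] := sphere_curve x01 vx0.
  exists (F \o c); split; first by rewrite /= c0.
    by move=> t; exists (c t).
  have := is_derive_comp_diff dc (dF (c 0)).
  rewrite -deriveE// deriveEjacobian// c0.
  by have := ME v; rewrite vx0 scale0r addr0 vM => <-.
have B0 : 0 < n%:R * `|invmx M| + 1 by rewrite ltr_wpDl// mulr_ge0.
set B := n%:R * `|invmx M| + 1 in B0.
have vB (v : 'rV[R]_n) : `|v| <= B * `|v *m M|.
  have := mulmx_norm_le (v *m M) (invmx M); rewrite mulmxK// => /le_trans; apply.
  by rewrite mulrAC ler_wpM2r// lerDl.
set m := nu - x0 *m jacobian F x0.
(* chords of the sphere are almost tangent, so F is almost linear with matrix M *)
have S eta : 0 < eta -> exists2 r, 0 < r & forall x y, sphere x -> sphere y ->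
    `|x - x0| < r -> `|y - x0| < r ->
    `|F x - F y - (x - y) *m M| <= eta * `|x - y| /\ `|dotp (x - y) x0| <= eta * `|x - y|.
  move=> eta0.
  have eta2 : 0 < eta / 2 by rewrite divr_gt0.
  (* K absorbs the dimension and the norm of the term m by which M differs from the jacobian *)
  pose K := n%:R * (2 * `|m| + 1) : R.
  have K0 : 0 < K by rewrite mulr_gt0// ltr_wpDl// mulr_ge0.
  have m1 : 2 * `|m| + 1 != 0 by rewrite gt_eqF// ltr_wpDl// mulr_ge0.
  have n0 : n%:R != 0 :> R by rewrite pnatr_eq0.
  have alg (p l s t u : R) : p != 0 -> t != 0 ->
      p * l * (s / (p * t)) * u = s * l * (u / t).
    by move=> p0 t0; field; rewrite p0 t0.
  have [r r0 rP] := strict_diff x0 dF cF eta2.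
  exists (Num.min r (eta / K)); first by rewrite lt_min r0 divr_gt0.
  move=> x y xS yS; rewrite !lt_min => /andP[xr xK] /andP[yr yK].
  have C : `|dotp (x - y) x0| <= n%:R * `|x - y| * (eta / K).
    have -> : dotp (x - y) x0 = dotp (x - y) (x0 - 2^-1 *: (x + y)).
      rewrite [RHS]dotpBr dotpZr.
      suff -> : dotp (x - y) (x + y) = 0 by rewrite mulr0 subr0.
      rewrite dotpBl !dotpDr (dotpC y x) ((sphere_dotp x).1 xS) ((sphere_dotp y).1 yS); ring.
    apply: le_trans (dotp_le_norm _ _) _; apply: ler_wpM2l; first by rewrite mulr_ge0.
    have -> : x0 - 2^-1 *: (x + y) = 2^-1 *: (x0 - x) + 2^-1 *: (x0 - y).
      by apply/rowP => j; rewrite !mxE; field.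
    apply: le_trans (ler_normD _ _) _; rewrite !normrZ (distrC x0) (distrC x0 y).
    rewrite gtr0_norm ?invr_gt0// [leRHS](splitr (eta / K)) ![_ / 2]mulrC.
    by apply: lerD; rewrite ler_wpM2l ?invr_ge0// ltW.
  split.
    rewrite ME opprD addrA; apply: le_trans (ler_normB _ _) _.
    rewrite (splitr eta) mulrDl; apply: lerD; first exact: rP.
    rewrite normrZ; apply: le_trans (ler_wpM2r (normr_ge0 _) C) _.
    rewrite -/m; have -> : n%:R * `|x - y| * (eta / K) * `|m| =
        eta * `|x - y| * (`|m| / (2 * `|m| + 1)).
      by rewrite /K; exact: alg.
    rewrite [leRHS]mulrAC; apply: ler_wpM2l.
      by rewrite mulr_ge0// ltW.
    rewrite ler_pdivrMr ?ltr_wpDl ?mulr_ge0//.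
    by rewrite mulrDr mulrA mulVf// mul1r lerDl.
  apply: le_trans C _.
  have -> : n%:R * `|x - y| * (eta / K) = eta * `|x - y| * (2 * `|m| + 1)^-1.
    by have := alg _ `|x - y| eta _ 1 n0 m1; rewrite mulr1 mul1r.
  apply: ler_piMr; first by rewrite mulr_ge0// ltW.
  by rewrite invf_le1 ?ltr_wpDl ?mulr_ge0// lerDr mulr_ge0.
move=> e e0.
pose L := dotp nu nu + n%:R * `|nu|.
have L0 : 0 <= L by rewrite addr_ge0 ?dotp_ge0// mulr_ge0.
(* with the first bound, F shrinks chords at most by the factor 2 * B *)
pose eta := Num.min (2 * B)^-1 (e / (2 * B * (L + 1))).
have L1 : 0 < L + 1 by rewrite ltr_wpDl.
have eta0 : 0 < eta by rewrite lt_min invr_gt0 divr_gt0 ?mulr_gt0.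
have [r r0 rP] := S eta eta0.
have hV : hausdorff_space 'rV[R]_n by exact: norm_hausdorff.
have cFS : {within @sphere R n, continuous F}.
  by apply: continuous_subspaceT; have := CF 0%N.
have inj0 x : sphere x -> F x = F x0 -> x = x0.
  by move=> xS; apply: injF; rewrite inE.
have := compact_near_preimage hV (@compact_sphere n) cFS inj0 (nbhsx_ballx x0 r r0).
move=> /nbhs_ballP[r' /= r'0 r'P]; exists r' => //.
have near0 x : sphere x -> `|F x - F x0| < r' -> `|x - x0| < r.
  move=> xS xr; have Bx : ball (F x0) r' (F x) by rewrite -ball_normE/= distrC.
  by have := r'P _ Bx x xS erefl; rewrite -ball_normE/= distrC.
move=> _ _ [x xS <-] [y yS <-] xr yr.
have [lin tan] := rP x y xS yS (near0 x xS xr) (near0 y yS yr).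
have xyF : `|x - y| <= 2 * B * `|F x - F y|.
  have H1 := vB (x - y).
  have H2 : `|(x - y) *m M| <= `|F x - F y| + eta * `|x - y|.
    rewrite -[X in `|X|](subKr (F x - F y)); apply: le_trans (ler_normB _ _) _.
    by rewrite lerD2l.
  have H3 : eta <= (2 * B)^-1 by rewrite ge_min lexx.
  have H4 : B * (eta * `|x - y|) <= 2^-1 * `|x - y|.
    rewrite mulrA ler_wpM2r// -ler_pdivlMl//.
    by apply: le_trans H3 _; rewrite invfM mulrC.
  have H5 : B * `|(x - y) *m M| <= B * `|F x - F y| + B * (eta * `|x - y|).
    by rewrite -mulrDr ler_wpM2l// ltW.
  lra.
have -> : dotp nu (F x - F y) = dotp nu ((x - y) *m M) + dotp nu (F x - F y - (x - y) *m M).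
  by rewrite -dotpDr [_ *m _ + _]addrC subrK.
apply: le_trans (ler_normD _ _) _.
have T1 : `|dotp nu ((x - y) *m M)| <= eta * `|x - y| * dotp nu nu.
  by rewrite dotpC Mnu normrM [`|dotp nu nu|]ger0_norm ?dotp_ge0// ler_wpM2r ?dotp_ge0.
have T2 : `|dotp nu (F x - F y - (x - y) *m M)| <= n%:R * `|nu| * (eta * `|x - y|).
  by apply: le_trans (dotp_le_norm _ _) _; rewrite ler_wpM2l// mulr_ge0.
apply: le_trans (lerD T1 T2) _.
rewrite (mulrC (n%:R * _)) -mulrDr -/L.
apply: (@le_trans _ _ (eta * (2 * B * `|F x - F y|) * (L + 1))).
  apply: ler_pM => //; first by rewrite mulr_ge0// ltW.
    by rewrite ler_wpM2l// ltW.
  by rewrite lerDl.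
have : eta <= e / (2 * B * (L + 1)) by rewrite ge_min lexx orbT.
rewrite ler_pdivlMr ?mulr_gt0// => H.
rewrite (_ : eta * _ * _ = eta * (2 * B * (L + 1)) * `|F x - F y|); last by ring.
by rewrite ler_wpM2r.
Qed.

End EmbeddedSphere.

(** * Hypersurfaces of revolution *)

(** McShane's formula. *)
Lemma lipschitz_extension (R : realType) (A : set R) (g : R -> R) :
  A !=set0 -> (forall s t, A s -> A t -> `|g s - g t| <= `|s - t|) ->
  exists2 h : R -> R, (forall s t, `|h s - h t| <= `|s - t|) & forall s, A s -> h s = g s.
Proof.
move=> [a Aa] gL; pose S s := [set g t + `|s - t| | t in A].
have S0 s : S s !=set0 by exists (g a + `|s - a|), a.
have Slb s : lbound (S s) (g a - `|s - a|).
  move=> _ [t At <-]; have := gL a t Aa At; have := ler_norm (g a - g t).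
  have := ler_distD s a t; rewrite (distrC a s); lra.
have hS s : has_inf (S s) by split => //; exists (g a - `|s - a|).
exists (fun s => inf (S s)); last first.
  move=> s As; apply/eqP; rewrite eq_le; apply/andP; split.
    by apply: ge_inf; [have [] := hS s|exists s => //; rewrite subrr normr0 addr0].
  apply: lb_le_inf => // _ [t At <-].
  have := gL s t As At; have := ler_norm (g s - g t); lra.
have H s t : inf (S s) - inf (S t) <= `|s - t|.
  rewrite lerBlDr -lerBlDl; apply: lb_le_inf => // _ [u Au <-].
  have B : inf (S s) <= g u + `|s - u| by apply: ge_inf; [have [] := hS s|exists u].
  have := ler_distD t s u; lra.
move=> s t; rewrite ler_norml H andbT.
by have := H t s; rewrite distrC; lra.
Qed.

Section LipschitzLimits.
Context {R : realType}.

Lemma lipschitz_continuous (h : R -> R) :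
  (forall s t, `|h s - h t| <= `|s - t|) -> continuous h.
Proof.
move=> hL s; apply/cvgrPdist_le => e e0; near=> t.
by apply: le_trans (hL s t) _; near: t; exact: cvgr_dist_le.
Unshelve. all: by end_near. Qed.

Lemma derive_le1_lipschitz (D : R) (g : R -> R) :
  (forall s, 0 < s < D -> derivable g s 1) ->
  (forall s, 0 < s < D -> `|derive1 g s| <= 1) ->
  forall s t, 0 < s < D -> 0 < t < D -> `|g s - g t| <= `|s - t|.
Proof.
move=> dg g1 s t; wlog ts : s t / t <= s.
  move=> H sD tD; have [ts|/ltW st] := leP t s; first exact: H.
  by rewrite distrC (distrC s); exact: H.
move=> /andP[s0 sD] /andP[t0 tD].
have I x : t <= x <= s -> 0 < x < D.
  by move=> /andP[tx xs]; rewrite (lt_le_trans t0)//= (le_lt_trans xs).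
have ctn : {within `[t, s], continuous g}.
  by apply: derivable_within_continuous => x; rewrite in_itv/= => /I /dg.
have dgx x : x \in `]t, s[ -> is_derive x 1 g (derive1 g x).
  rewrite in_itv/= => /andP[tx xs]; rewrite derive1E; apply/derivableP/dg/I.
  by rewrite !ltW.
move: ts; rewrite le_eqVlt => /predU1P[->|ts]; first by rewrite !subrr.
have [x + ->] := MVT ts dgx ctn; rewrite in_itv/= => /andP[tx xs].
by rewrite normrM ler_piMl// g1// I// !ltW.
Qed.

End LipschitzLimits.

(** The hypersurface obtained by rotating the unit speed curve [(z, f)] around the first axis.
    Both functions are defined and Lipschitz on the whole line, so that their values at
    [0] and [D] are the limits of the geodesic coordinates. *)
Record hypersurface_of_revolution (R : realType) (d : nat) (Sigma : set 'rV[R]_(1 + d))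
    (D : R) (f z : R -> R) : Prop := {
  rev_gt0 : 0 < D ;
  rev_f_lip : forall s t, `|f s - f t| <= `|s - t| ;
  rev_z_lip : forall s t, `|z s - z t| <= `|s - t| ;
  rev_df : forall s, 0 < s < D -> derivable f s 1 ;
  rev_dz : forall s, 0 < s < D -> derivable z s 1 ;
  rev_cf : forall s, 0 < s < D -> {for s, continuous (derive1 f)} ;
  rev_cz : forall s, 0 < s < D -> {for s, continuous (derive1 z)} ;
  rev_arclength : forall s, 0 < s < D -> derive1 z s ^+ 2 + derive1 f s ^+ 2 = 1 ;
  rev_f_gt0 : forall s, 0 < s < D -> 0 < f s ;
  rev_f0 : f 0 = 0 ;
  rev_df0 : derive1 f s @[s --> 0^'+] --> (1 : R) ;
  rev_image : Sigma = [set x | exists s th, [/\ 0 <= s <= D, sphere th & x = rot_coord z f s th]] ;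
  rev_inj : forall s1 s2 (th1 th2 : 'rV[R]_d), 0 < s1 < D -> 0 <= s2 <= D ->
    sphere th1 -> sphere th2 -> rot_coord z f s1 th1 = rot_coord z f s2 th2 ->
    s1 = s2 /\ th1 = th2
}.

Section GeodesicCoordinates.
Context {R : realType} {d : nat} {Sigma : set 'rV[R]_(1 + d)} {p : 'rV[R]_(1 + d)}.
Context {D : R} {f k z : R -> R}.
Hypothesis d_gt0 : (0 < d)%N.
Hypothesis clS : closed Sigma.
Hypothesis G : geodesic_spherical_coord Sigma p D f k z.

Lemma exists_sphere : exists th : 'rV[R]_d, sphere th.
Proof.
case: d d_gt0 => // m _; exists (delta_mx 0 0).
by apply/sphere_dotp; rewrite dotp_delta mxE !eqxx.
Qed.

Lemma smooth_itv_C1 (g : R -> R) : smooth_on_itv 0 D g -> forall s, 0 < s < D ->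
  derivable g s 1 /\ {for s, continuous (derive1 g)}.
Proof.
move=> gs s sD; split; first exact: (gs 0%N).
apply: differentiable_continuous; apply/derivable1_diffP; exact: (gs 1%N).
Qed.

Lemma cvg_row_mx_scale {T : Type} {F : set_system T} {FF : Filter F}
    (h g : T -> R) (a b : R) (th : 'rV[R]_d) :
  h x @[x --> F] --> a -> g x @[x --> F] --> b ->
  (row_mx (const_mx (h x) : 'rV[R]_1) (g x *: th) : 'rV[R]_(1 + d)) @[x --> F] -->
    (row_mx (const_mx a : 'rV[R]_1) (b *: th) : 'rV[R]_(1 + d)).
Proof.
move=> ha gb; apply: cvg_rV => i; rewrite -(splitK i).
case: (fintype.split i) => j /=.
- by rewrite row_mxEl mxE; under eq_cvg do rewrite row_mxEl mxE.
- rewrite row_mxEr mxE; under eq_cvg do rewrite row_mxEr mxE.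
  by apply: cvgM => //; exact: cvg_cst.
Qed.

(** A curve of unit speed is Lipschitz, hence has limits at both ends of its interval. The cut locus is
    the parallel at arc length [D], and lies on [Sigma] because [Sigma] is closed. *)
Lemma gsc_revolution : exists fe ze, hypersurface_of_revolution Sigma D fe ze.
Proof.
have D0 := gsc_Dp G.
have arc := gsc_arclength G.
have df s : 0 < s < D -> derivable f s 1 by move=> /(smooth_itv_C1 (gsc_f_smooth G))[].
have dz s : 0 < s < D -> derivable z s 1 by move=> /(smooth_itv_C1 (gsc_z_smooth G))[].
have cf s : 0 < s < D -> {for s, continuous (derive1 f)}.
  by move=> /(smooth_itv_C1 (gsc_f_smooth G))[].
have cz s : 0 < s < D -> {for s, continuous (derive1 z)}.
  by move=> /(smooth_itv_C1 (gsc_z_smooth G))[].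
have sq1 (t : R) : t ^+ 2 <= 1 -> `|t| <= 1.
  by move=> t1; rewrite -ler_sqr ?nnegrE// real_normK ?num_real// expr1n.
have f1 s : 0 < s < D -> `|derive1 f s| <= 1.
  by move=> /arc E; apply: sq1; rewrite -E lerDr sqr_ge0.
have z1 s : 0 < s < D -> `|derive1 z s| <= 1.
  by move=> /arc E; apply: sq1; rewrite -E lerDl sqr_ge0.
have I0 : [set s | 0 < s < D] !=set0 by exists (D / 2) => /=; rewrite divr_gt0//= gtr_pMr// invf_lt1// ltr1n.
have [fe feL feE] := lipschitz_extension I0 (derive_le1_lipschitz df f1).
have [ze zeL zeE] := lipschitz_extension I0 (derive_le1_lipschitz dz z1).
have cfe := lipschitz_continuous feL; have cze := lipschitz_continuous zeL.
have near_I s : 0 < s < D -> \forall t \near s, 0 < t < D.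
  move=> /andP[s0 sD]; near=> t; apply/andP; split; near: t; [exact: lt_nbhsr|exact: lt_nbhsl].
have derE (g h : R -> R) : (forall s, 0 < s < D -> g s = h s) ->
    forall s, 0 < s < D -> derivable h s 1 -> derivable g s 1 /\ derive1 g s = derive1 h s.
  move=> gh s sD dh.
  have E : \forall t \near s, h t = g t.
    by apply: filterS (near_I s sD) => t /gh.
  have D1 : is_derive s 1 g (derive1 h s).
    by apply: (near_eq_is_derive E); rewrite derive1E; exact: derivableP.
  by split; [exact: (@ex_derive _ _ _ _ _ _ _ D1)|rewrite derive1E (@derive_val _ _ _ _ _ _ _ D1)].
have derC (g h : R -> R) : (forall s, 0 < s < D -> g s = h s) ->
    (forall s, 0 < s < D -> derivable h s 1) ->
    forall s, 0 < s < D -> {for s, continuous (derive1 h)} -> {for s, continuous (derive1 g)}.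
  move=> gh dh s sD C; suff : derive1 g t @[t --> s] --> derive1 g s by [].
  rewrite (derE g h gh s sD (dh s sD)).2.
  apply: cvg_trans C; apply: near_eq_cvg; near=> t.
  have tD : 0 < t < D by near: t; exact: near_I.
  by rewrite (derE g h gh t tD (dh t tD)).2.
have near0 : \forall s \near (0 : R)^'+, 0 < s < D.
  by near=> s; apply/andP; split; near: s; [exact: nbhs_right_gt|exact: nbhs_right_lt].
have nearD : \forall s \near D^'-, 0 < s < D.
  by near=> s; apply/andP; split; near: s; [exact: nbhs_left_gt|exact: nbhs_left_lt].
have lim0 (g h : R -> R) : continuous h -> (forall s, 0 < s < D -> h s = g s) ->
    g s @[s --> 0^'+] --> h 0.
  move=> ch hg; have C : h s @[s --> 0^'+] --> h 0 by apply: cvg_at_right_filter; exact: ch.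
  by apply: cvg_trans C; apply: near_eq_cvg; apply: filterS near0 => s /hg.
have limD (g h : R -> R) : continuous h -> (forall s, 0 < s < D -> h s = g s) ->
    g s @[s --> D^'-] --> h D.
  move=> ch hg; have C : h s @[s --> D^'-] --> h D by apply: cvg_at_left_filter; exact: ch.
  by apply: cvg_trans C; apply: near_eq_cvg; apply: filterS nearD => s /hg.
have hV : hausdorff_space 'rV[R]_(1 + d) by exact: norm_hausdorff.
have fe0 : fe 0 = 0.
  have := cvg_unique _ (lim0 _ _ cfe feE) (gsc_f0 G).
  by apply; exact: norm_hausdorff.
have [th0 th0S] := exists_sphere.
have pE (th : 'rV[R]_d) : sphere th -> p = rot_coord ze fe 0 th.
  move=> thS; apply: (cvg_unique hV (gsc_center G thS)).
  exact: (cvg_row_mx_scale (lim0 _ _ cze zeE) (lim0 _ _ cfe feE)).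
have rotE s (th : 'rV[R]_d) : 0 < s < D -> rot_coord z f s th = rot_coord ze fe s th.
  by move=> sD; rewrite /rot_coord feE// zeE.
have cutE (th : 'rV[R]_d) : sphere th -> rot_coord z f s th @[s --> D^'-] --> rot_coord ze fe D th.
  by move=> _; exact: (cvg_row_mx_scale (limD _ _ cze zeE) (limD _ _ cfe feE)).
have img := gsc_image G.
have imS s (th : 'rV[R]_d) : 0 < s < D -> sphere th -> Sigma (rot_coord z f s th) /\
    ~ ([set p] `|` cut_locus D (@rot_coord R d z f)) (rot_coord z f s th).
  move=> sD thS.
  have : (Sigma `\` ([set p] `|` cut_locus D (@rot_coord R d z f))) (rot_coord z f s th).
    by rewrite -img; exists s, th.
  by [].
have cutS (th : 'rV[R]_d) : sphere th -> Sigma (rot_coord ze fe D th).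
  move=> thS; apply: (closed_cvg Sigma clS _ _ (cutE th thS)).
  by apply: filterS nearD => s sD; have [] := imS s th sD thS.
exists fe, ze; split => //.
- by move=> s sD; have [] := derE _ _ feE s sD (df s sD).
- by move=> s sD; have [] := derE _ _ zeE s sD (dz s sD).
- by move=> s sD; exact: (derC _ _ feE df s sD (cf s sD)).
- by move=> s sD; exact: (derC _ _ zeE dz s sD (cz s sD)).
- move=> s sD; have [_ ->] := derE _ _ feE s sD (df s sD).
  by have [_ ->] := derE _ _ zeE s sD (dz s sD); exact: arc.
- by move=> s sD; rewrite feE//; exact: (gsc_f_gt0 G).
- apply: cvg_trans (gsc_df0 G); apply: near_eq_cvg; apply: filterS near0 => s sD.
  by have [_ ->] := derE _ _ feE s sD (df s sD).
- apply/seteqP; split => x.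
  + move=> Sx; have [xc|xn] := pselect (([set p] `|` cut_locus D (@rot_coord R d z f)) x).
      case: xc => [->|[th thS xth]].
        by exists 0, th0; rewrite lexx ltW//; split => //; exact: pE.
      exists D, th; rewrite lexx ltW//; split => //.
      exact: (cvg_unique hV xth (cutE th thS)).
    have : (Sigma `\` ([set p] `|` cut_locus D (@rot_coord R d z f))) x by [].
    rewrite -img => -[s [th [sD thS ->]]]; exists s, th; rewrite rotE//.
    by case/andP: sD => /ltW -> /ltW ->.
  + move=> [s [th [/andP[s0 sD] thS ->]]].
    move: s0; rewrite le_eqVlt => /predU1P[<-|s0]; first by rewrite -pE//; exact: (gsc_p G).
    move: sD; rewrite le_eqVlt => /predU1P[->|sD]; first exact: cutS.
    have I : 0 < s < D by rewrite s0.
    by rewrite -rotE//; have [] := imS s th I thS.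
- move=> s1 s2 th1 th2 I1 /andP[s20 s2D] th1S th2S.
  move: s20; rewrite le_eqVlt => /predU1P[<-|s20].
    rewrite -rotE// -pE// => E; have [_] := imS s1 th1 I1 th1S.
    by case; left; rewrite E.
  move: s2D; rewrite le_eqVlt => /predU1P[->|s2D].
    rewrite -rotE// => E; have [_] := imS s1 th1 I1 th1S.
    by case; right; exists th2 => //; rewrite E; exact: cutE.
  have I2 : 0 < s2 < D by rewrite s20.
  by rewrite -!rotE//; exact: (gsc_inj G).
Unshelve. all: by end_near. Qed.

End GeodesicCoordinates.

(** * The profile curve closes up at a second pole *)

Lemma ler0_eps (R : realType) (x c : R) : 0 <= c -> (forall e, 0 < e -> x <= e * c) -> x <= 0.
Proof.
move=> c0 H; apply/ler_addgt0Pl => e e0; rewrite addr0.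
apply: le_trans (H (e / (c + 1)) _) _; first by rewrite divr_gt0// ltr_wpDl.
by rewrite mulrAC ler_pdivrMr ?ltr_wpDl// ler_wpM2l ?lerDl// ltW.
Qed.

Section Velocity.
Context {R : realType}.

Lemma is_derive_cvg (V : normedModType R) (c : R -> V) (t : R) (w : V) :
  is_derive t 1 c w -> h^-1 *: (c (t + h) - c t) @[h --> 0^'] --> w.
Proof.
move=> D; rewrite -(@derive_val _ _ _ _ _ _ _ D).
have := @ex_derive _ _ _ _ _ _ _ D.
rewrite /derivable /derive /=.
have -> : (fun h : R => h^-1 *: (c (h%:A + t) - c t)) = (fun h => h^-1 *: (c (t + h) - c t)).
  by apply/funext => h; rewrite [_%:A]mulr1 (addrC h).
by [].
Qed.

Lemma is_derive_continuous (V : normedModType R) (c : R -> V) (t : R) (w : V) :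
  is_derive t 1 c w -> {for t, continuous c}.
Proof.
move=> D; apply: differentiable_continuous; apply/derivable1_diffP.
exact: (@ex_derive _ _ _ _ _ _ _ D).
Qed.

Lemma derive_gt0_sides (psi : R -> R) (l : R) (P : R -> Prop) :
  0 < l -> is_derive (0 : R) 1 psi l -> (\forall t \near 0, P t) ->
  (exists2 t, P t & psi 0 < psi t) /\ (exists2 t, P t & psi t < psi 0).
Proof.
move=> l0 D nP.
have := is_derive_cvg D => /cvgr_gt/(_ 0 l0) gt.
have {}gt : \forall h \near (0 : R), h != 0 -> 0 < h^-1 *: (psi (0 + h) - psi 0).
  by move: gt; rewrite near_withinE.
have [r /= r0 rP] : exists2 r, 0 < r & forall t, `|t| < r ->
    P t /\ (t != 0 -> 0 < t^-1 * (psi t - psi 0)).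
  have : \forall t \near (0 : R), P t /\ (t != 0 -> 0 < t^-1 * (psi t - psi 0)).
    near=> t; split; first by near: t.
    by rewrite -{3}(add0r t); near: t.
  move=> /nbhs_ballP[r /= r0 rP]; exists r => // t tr; apply: rP.
  by rewrite /ball/= sub0r normrN.
have r2 : 0 < r / 2 by rewrite divr_gt0.
have rr : r / 2 < r by rewrite gtr_pMr// invf_lt1// ltr1n.
split.
- have [|Pt] := rP (r / 2); first by rewrite gtr0_norm.
  rewrite gt_eqF// => /(_ isT); rewrite pmulr_rgt0 ?invr_gt0// subr_gt0 => ?.
  by exists (r / 2).
- have [|Pt] := rP (- (r / 2)); first by rewrite normrN gtr0_norm.
  rewrite oppr_eq0 gt_eqF// => /(_ isT).
  rewrite invrN mulNr oppr_gt0 pmulr_rlt0 ?invr_gt0// subr_lt0 => ?.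
  by exists (- (r / 2)).
Unshelve. all: by end_near. Qed.

(** Chords through [q] are almost orthogonal to [nu], hence velocities at [q] are
    orthogonal to [nu]. *)
Lemma velocity_orthogonal n (Sigma : set 'rV[R]_n) (q nu w : 'rV[R]_n) (c : R -> 'rV[R]_n) :
  Sigma q ->
  (forall e, 0 < e -> exists2 r, 0 < r & forall x y, Sigma x -> Sigma y ->
      `|x - q| < r -> `|y - q| < r -> `|dotp nu (x - y)| <= e * `|x - y|) ->
  c 0 = q -> (\forall t \near 0, Sigma (c t)) -> is_derive (0 : R) 1 c w ->
  dotp nu w = 0.
Proof.
move=> Sq N c0 cS D; apply/eqP; rewrite -normr_le0.
apply: (@ler0_eps _ _ `|w|) => // e e0; have [r r0 rN] := N e e0.
have C := is_derive_cvg D.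
have C1 : `|dotp nu (h^-1 *: (c (0 + h) - c 0))| @[h --> 0^'] --> `|dotp nu w|.
  by apply: cvg_norm; apply: cvg_dotp => //; exact: cvg_cst.
have C2 : e * `|h^-1 *: (c (0 + h) - c 0)| @[h --> 0^'] --> e * `|w|.
  by apply: cvgM; [exact: cvg_cst|exact: cvg_norm].
apply: ler_cvg_to C1 C2 _.
have near_c : \forall h \near (0 : R), `|c h - q| < r.
  have r2 : 0 < r / 2 by rewrite divr_gt0.
  have cc := near_at_dist (is_derive_continuous D) r2; rewrite c0 in cc.
  near=> h; rewrite distrC; apply: (@le_lt_trans _ _ (r / 2)); first by near: h.
  by rewrite gtr_pMr// invf_lt1// ltr1n.
have H : \forall h \near (0 : R),
    `|dotp nu (h^-1 *: (c (0 + h) - c 0))| <= e * `|h^-1 *: (c (0 + h) - c 0)|.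
  near=> h; rewrite add0r c0 dotpZr normrM normrZ mulrCA; apply: ler_wpM2l => //.
  apply: rN => //; first by near: h.
    by near: h.
  by rewrite subrr normr0.
by rewrite near_withinE; apply: filterS H => h Hh _.
Unshelve. all: by end_near. Qed.

End Velocity.

Section SecondPole.
Context {R : realType} {d : nat} {Sigma : set 'rV[R]_(1 + d)} {D : R} {f z : R -> R}.
Hypothesis d_gt1 : (1 < d)%N.
Hypothesis hS : embedded_sphere Sigma.
Hypothesis H : hypersurface_of_revolution Sigma D f z.
Local Notation P := (@rot_coord R d z f).

Lemma row_decomposition (u : 'rV[R]_(1 + d)) :
  exists a v, u = row_mx (const_mx a : 'rV[R]_1) v.
Proof.
exists (u 0 (lshift d 0)), (rsubmx u); rewrite -{1}(hsubmxK u); congr row_mx.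
by apply/rowP => i; rewrite ord1 !mxE.
Qed.

Lemma dotp_rot (a : R) (v th : 'rV[R]_d) s :
  dotp (row_mx (const_mx a : 'rV[R]_1) v) (P s th) = a * z s + f s * dotp v th.
Proof. by rewrite dotp_row_mx dotp_const dotpZr. Qed.

Lemma rot_in s th : 0 <= s <= D -> sphere th -> Sigma (P s th).
Proof. by move=> sD thS; rewrite (rev_image H); exists s, th. Qed.

Lemma rot_dist s t (th : 'rV[R]_d) : sphere th ->
  `|P s th - P t th| <= `|z s - z t| + `|f s - f t|.
Proof.
move=> th1; apply: rV_norm_le => [|i]; first by rewrite addr_ge0.
have E (u v : 'rV[R]_(1 + d)) : (u - v) 0 i = u 0 i - v 0 i by rewrite !mxE.
rewrite E -(splitK i); case: (fintype.split i) => j /=.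
- by rewrite !row_mxEl !mxE lerDl.
- rewrite !row_mxEr !mxE -mulrBl normrM; apply: (@le_trans _ _ `|f s - f t|).
    by apply: ler_piMr => //; rewrite -(th1 : enorm th = 1) coord_le_enorm.
  by rewrite lerDr.
Qed.

Lemma rot_near (th : 'rV[R]_d) t r : 0 < r -> sphere th ->
  \forall s \near t, `|P s th - P t th| < r.
Proof.
move=> r0 thS; have r2 : 0 < r / 2 by rewrite divr_gt0.
near=> s; apply: le_lt_trans (rot_dist s t thS) _.
apply: le_lt_trans (lerD (rev_z_lip H s t) (rev_f_lip H s t)) _.
have : `|t - s| < r / 2 by near: s; exact: (nbhsx_ballx t (r / 2) r2).
rewrite distrC; lra.
Unshelve. all: by end_near. Qed.

Lemma rev_f_ge0 s : 0 <= s <= D -> 0 <= f s.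
Proof.
move=> /andP[s0 sD].
move: s0; rewrite le_eqVlt => /predU1P[<-|s0]; first by rewrite (rev_f0 H).
move: sD; rewrite le_eqVlt => /predU1P[->|sD]; last by rewrite ltW// (rev_f_gt0 H)// s0.
rewrite leNgt; apply/negP => fD0; have D0 := rev_gt0 H.
pose m := Num.min (D / 2) (- f D / 2).
have m0 : 0 < m by rewrite lt_min !divr_gt0// oppr_gt0.
have m1 : m <= D / 2 by rewrite ge_min lexx.
have m2 : m <= - f D / 2 by rewrite ge_min lexx orbT.
have tD : 0 < D - m < D by apply/andP; split; lra.
have := rev_f_gt0 H tD; have := le_trans (ler_norm _) (rev_f_lip H (D - m) D).
rewrite (_ : D - m - D = - m); last by ring.
rewrite normrN gtr0_norm//; lra.
Qed.

(** If the last parallel had positive radius [f D], let [q] be one of its points, [nu] a normal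
    at [q] and [w] the tangent vector at [q] in the plane of the meridian. A curve on [Sigma]
    with velocity [w] crosses the parallel. But [Psi], the component of the meridian
    along [w], cannot take its end value near [D], hence has a strict extremum
    there. *)
Lemma profile_end : f D = 0.
Proof.
have D0 := rev_gt0 H.
have DD : 0 <= D <= D by rewrite lexx ltW.
apply/eqP; rewrite eq_le rev_f_ge0// andbT leNgt; apply/negP => L0.
have [th0 th0S] : exists th : 'rV[R]_d, sphere th by apply: exists_sphere; exact: ltnW.
have th01 := (sphere_dotp th0).1 th0S.
pose q := P D th0.
have Sq : Sigma q by exact: rot_in.
have [nu [nu0 N W]] := embedded_sphere_normal hS Sq.
have [n0 [ny nuE]] := row_decomposition nu.
have ny_par u : dotp u th0 = 0 -> dotp ny u = 0.
  move=> u0; have [c [c0 cS dc]] := sphere_curve th01 u0.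
  have dPc : is_derive (0 : R) 1 (fun t => P D (c t)) (row_mx (const_mx 0 : 'rV[R]_1) (f D *: u)).
    apply/is_derive_rV => j; rewrite -(splitK j); case: (fintype.split j) => l /=.
    - have -> : (fun t => P D (c t) 0 (lshift d l)) = cst (z D).
        by apply/funext => t; rewrite row_mxEl mxE.
      by rewrite row_mxEl mxE; exact: is_derive_cst.
    - have -> : (fun t => P D (c t) 0 (rshift 1 l)) = f D *: (fun t => c t 0 l).
        by apply/funext => t; rewrite row_mxEr mxE.
      by rewrite row_mxEr mxE; apply: is_deriveZ; exact: (is_derive_rV _ _ _).1.
  have E0 : P D (c 0) = q by rewrite c0.
  have cin : \forall t \near (0 : R), Sigma (P D (c t)).
    by near=> t; exact: rot_in.
  have := velocity_orthogonal Sq N E0 cin dPc.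
  rewrite nuE dotp_row_mx dotp_const mulr0 add0r dotpZr => /eqP.
  by rewrite mulf_eq0 gt_eqF//= => /eqP.
pose n1 := dotp ny th0.
have nyE : ny = n1 *: th0.
  apply/eqP; rewrite -subr_eq0 -dotp_eq0.
  have u0 : dotp (ny - n1 *: th0) th0 = 0 by rewrite dotpBl dotpZl th01 mulr1 subrr.
  by rewrite {1}dotpBl dotpZl ny_par// (dotpC th0) u0 mulr0 subrr.
pose N2 := n0 ^+ 2 + n1 ^+ 2.
have N20 : 0 < N2.
  rewrite lt0r addr_ge0 ?sqr_ge0// andbT; apply: contra nu0.
  rewrite paddr_eq0 ?sqr_ge0// !sqrf_eq0 => /andP[/eqP n00 /eqP n10].
  by rewrite nuE nyE n00 n10 scale0r row_mx0.
pose Psi s := - n1 * z s + n0 * f s.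
(* Psi s = Psi D would make the chord from s to D normal *)
have Psi_ne : \forall s \near D, 0 < s < D -> Psi s != Psi D.
  pose K := `|n0| + `|n1| + 1.
  have K0 : 0 < K by rewrite ltr_wpDl// addr_ge0.
  have e0 : 0 < N2 / (2 * K) by rewrite divr_gt0// mulr_gt0.
  have [r r0 rN] := N _ e0.
  have nr := rot_near D r0 th0S.
  near=> s; move=> sD; apply/negP => /eqP PsiE.
  have rs : `|P s th0 - q| < r by near: s.
  have Ss : Sigma (P s th0) by apply: rot_in => //; case/andP: sD => /ltW -> /ltW ->.
  have qr : `|q - q| < r by rewrite subrr normr0.
  have := rN _ _ Ss Sq rs qr.
  rewrite nuE dotpBr !dotp_rot -/n1.
  have := rot_dist s D th0S; rewrite -/q.
  set dz := z s - z D; set df := f s - f D => dist.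
  have -> : n0 * z s + f s * n1 - (n0 * z D + f D * n1) = n0 * dz + n1 * df.
    by rewrite /dz /df; ring.
  set c := n0 * dz + n1 * df => cB.
  have w0 : n0 * df = n1 * dz.
    by rewrite /dz /df; move: PsiE; rewrite /Psi => ?; lra.
  have dzE : N2 * dz = n0 * c.
    have : n1 * (n0 * df) = n1 * (n1 * dz) by rewrite w0.
    rewrite /N2 /c; lra.
  have dfE : N2 * df = n1 * c.
    have : n0 * (n0 * df) = n0 * (n1 * dz) by rewrite w0.
    rewrite /N2 /c; lra.
  have Bz : N2 * `|dz| = `|n0| * `|c| by rewrite -(gtr0_norm N20) -!normrM dzE.
  have Bf : N2 * `|df| = `|n1| * `|c| by rewrite -(gtr0_norm N20) -!normrM dfE.
  have cB2 : 2 * K * `|c| <= N2 * (`|dz| + `|df|).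
    have -> : N2 * (`|dz| + `|df|) = 2 * K * (N2 / (2 * K) * (`|dz| + `|df|)).
      by field; rewrite gt_eqF.
    apply: ler_wpM2l; first by rewrite mulr_ge0// ltW.
    by apply: le_trans cB _; apply: ler_wpM2l => //; exact: ltW.
  have c0 : `|c| = 0.
    apply/eqP; rewrite eq_le normr_ge0 andbT.
    have := normr_ge0 c; move: cB2; rewrite [N2 * _]mulrDr Bz Bf /K => cB2 cge0.
    have n0c : 0 <= `|n0| * `|c| by rewrite mulr_ge0.
    have n1c : 0 <= `|n1| * `|c| by rewrite mulr_ge0.
    lra.
  have dz0 : dz = 0.
    by apply/eqP; move/eqP: Bz; rewrite c0 mulr0 mulf_eq0 gt_eqF//= normr_eq0.
  have df0 : df = 0.
    by apply/eqP; move/eqP: Bf; rewrite c0 mulr0 mulf_eq0 gt_eqF//= normr_eq0.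
  have E : P s th0 = P D th0.
    by rewrite /rot_coord (subr0_eq dz0) (subr0_eq df0).
  have [sE _] := rev_inj H sD DD th0S th0S E.
  by move: sD; rewrite sE ltxx andbF.
pose w := row_mx (const_mx (- n1) : 'rV[R]_1) (n0 *: th0).
have nuw : dotp nu w = 0.
  by rewrite nuE nyE dotp_row_mx dotp_const dotpZl dotpZr th01; ring.
have [c [c0 cS dc]] := W w nuw.
pose psi t := - n1 * c t 0 (lshift d 0) + n0 * enorm (rsubmx (c t)).
have rq : rsubmx (c 0) = f D *: th0 by rewrite c0 /q /rot_coord row_mxKr.
have fDth : f D *: th0 != 0.
  by rewrite scaler_eq0 gt_eqF//= -enorm_eq0 (th0S : enorm th0 = 1) oner_eq0.
have dc0 : is_derive (0 : R) 1 (fun t => c t 0 (lshift d 0)) (- n1).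
  by have := (is_derive_rV _ _ _).1 dc (lshift d 0); rewrite row_mxEl mxE.
have dcy : is_derive (0 : R) 1 (fun t => enorm (rsubmx (c t))) n0.
  have dr : is_derive (0 : R) 1 (fun t => rsubmx (c t)) (n0 *: th0).
    apply/is_derive_rV => j.
    have -> : (fun t => rsubmx (c t) 0 j) = (fun t => c t 0 (rshift 1 j)).
      by apply/funext => t; rewrite mxE.
    by have := (is_derive_rV _ _ _).1 dc (rshift 1 j); rewrite row_mxEr.
  have dE : is_diff (rsubmx (c 0)) (@enorm R d) (fun v => dotp (f D *: th0) v / enorm (f D *: th0)).
    by rewrite rq; exact: is_diff_enorm.
  have := is_derive_comp_diff dr (@ex_diff _ _ _ _ _ _ _ dE).
  rewrite (@diff_val _ _ _ _ _ _ _ dE) dotpZl dotpZr th01 enormZ (th0S : enorm th0 = 1).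
  by rewrite gtr0_norm// !mulr1 mulrAC mulfV ?gt_eqF// mul1r.
have dpsi : is_derive (0 : R) 1 psi N2.
  apply: (@is_derive_eq _ _ _ psi _ _ _ _ (is_deriveD (is_deriveZ (- n1) dc0) (is_deriveZ n0 dcy))).
  rewrite /GRing.scale/= /N2; ring.
have psiE s th : 0 <= s <= D -> sphere th -> - n1 * P s th 0 (lshift d 0) +
     n0 * enorm (rsubmx (P s th)) = Psi s.
  move=> sD thS; rewrite /rot_coord row_mxKr row_mxEl mxE enormZ (thS : enorm th = 1).
  by rewrite mulr1 ger0_norm// rev_f_ge0.
(* g rotates each point of Sigma into the meridian of q, where the parameter can be read *)
pose g (x : 'rV[R]_(1 + d)) : 'rV[R]_(1 + d) :=
  row_mx (const_mx (x 0 (lshift d 0)) : 'rV[R]_1) (enorm (rsubmx x) *: th0).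
have gE s th : 0 <= s <= D -> sphere th -> g (P s th) = P s th0.
  move=> sD thS; rewrite /g /rot_coord row_mxKr row_mxEl mxE enormZ (thS : enorm th = 1).
  by rewrite mulr1 ger0_norm// rev_f_ge0.
have cg : g (c t) @[t --> (0 : R)] --> q.
  have -> : q = g (c 0) by rewrite c0 /q gE.
  apply: cvg_row_mx_scale; first exact: is_derive_continuous dc0.
  exact: is_derive_continuous dcy.
have near_end r : 0 < r ->
    \forall t \near (0 : R), exists2 s, D - r < s <= D & psi t = Psi s.
  move=> r0.
  have hV : hausdorff_space 'rV[R]_(1 + d) by exact: norm_hausdorff.
  have cP : {within `[0, D], continuous (P ^~ th0)}.
    apply: continuous_subspaceT => s; apply: cvg_row_mx_scale.
      exact: lipschitz_continuous (rev_z_lip H) s.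
    exact: lipschitz_continuous (rev_f_lip H) s.
  have injD s : `[0, D]%classic s -> P s th0 = P D th0 -> s = D.
    rewrite /= in_itv/= => /andP[s0 sD] E.
    move: sD; rewrite le_eqVlt => /predU1P[//|sD].
    move: s0; rewrite le_eqVlt => /predU1P[s0|s0].
      move: E => /eq_row_mx[_]; rewrite -s0 (rev_f0 H) scale0r => /esym/eqP.
      by rewrite (negbTE fDth).
    have I : 0 < s < D by rewrite s0.
    by have [] := rev_inj H I DD th0S th0S E.
  have nD : nbhs D [set s | D - r < s].
    by apply: lt_nbhsr; rewrite ltrBlDr ltrDl.
  have Q := compact_near_preimage hV (@segment_compact R 0 D) cP injD nD.
  have {}Q : \forall t \near (0 : R),
      forall s, `[0, D]%classic s -> P s th0 = g (c t) -> D - r < s by exact: cg Q.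
  near=> t; have := cS t; rewrite (rev_image H) => -[s [th [sD thS cE]]].
  exists s; last by rewrite /psi cE psiE.
  have /andP[_ ->] := sD; rewrite andbT.
  have Qt : forall u, `[0, D]%classic u -> P u th0 = g (c t) -> D - r < u by near: t.
  by apply: Qt; [rewrite /= in_itv|rewrite cE gE].
have psi0 : psi 0 = Psi D by rewrite /psi c0 psiE.
have [r /= r0 rP] := (nbhs_ballP _ _).1 Psi_ne.
pose r1 := Num.min r D.
have r10 : 0 < r1 by rewrite lt_min r0.
have [[t1 [s1 s1D ->]] + [t2 [s2 s2D ->]]] := derive_gt0_sides N20 dpsi (near_end r1 r10).
rewrite psi0 => Ps1 Ps2.
have in_r s : D - r1 < s <= D -> s != D -> 0 < s < D /\ ball D r s.
  move=> /andP[sr sD] sneD; have sD' : s < D by rewrite lt_neqAle sneD.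
  have rr : r1 <= r by rewrite ge_min lexx.
  have rD : r1 <= D by rewrite ge_min lexx orbT.
  split; first by rewrite sD' andbT; lra.
  rewrite -ball_normE/= gtr0_norm ?subr_gt0//; lra.
have s1n : s1 != D by apply/eqP => E; move: Ps1; rewrite E ltxx.
have s2n : s2 != D by apply/eqP => E; move: Ps2; rewrite E ltxx.
have cPsi : continuous Psi.
  move=> s; apply: cvgD; apply: cvgM; try exact: cvg_cst.
    exact: lipschitz_continuous (rev_z_lip H) s.
  exact: lipschitz_continuous (rev_f_lip H) s.
have contra a b : D - r1 < a <= D -> a != D -> D - r1 < b <= D -> b != D -> a <= b ->
    Num.min (Psi a) (Psi b) <= Psi D <= Num.max (Psi a) (Psi b) -> False.
  move=> aD an bD bn ab mM.
  have [s] := IVT ab (continuous_subspaceT cPsi) mM.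
  rewrite in_itv/= => /andP[as_ sb].
  have [/andP[a0 _] _] := in_r a aD an; have [/andP[_ bD'] _] := in_r b bD bn.
  have sD : D - r1 < s <= D.
    by case/andP: aD => aD _; rewrite (lt_le_trans aD)//= (le_trans sb)// ltW.
  have sn : s != D by rewrite lt_eqF// (le_lt_trans sb).
  have [I B] := in_r s sD sn.
  by move=> /eqP; apply/negP; exact: rP.
case: (leP s1 s2) => [s12|/ltW s21].
  apply: (contra s1 s2) => //; rewrite ge_min le_max (ltW Ps1) (ltW Ps2).
  by rewrite orbT.
apply: (contra s2 s1) => //; rewrite ge_min le_max (ltW Ps1) (ltW Ps2).
by rewrite orbT.
Unshelve. all: by end_near. Qed.

End SecondPole.

Section TwoPoles.
Context {R : realType} {d : nat} {Sigma : set 'rV[R]_(1 + d)} {D : R} {f z : R -> R}.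
Hypothesis d_gt1 : (1 < d)%N.
Hypothesis hS : embedded_sphere Sigma.
Hypothesis H : hypersurface_of_revolution Sigma D f z.
Local Notation P := (@rot_coord R d z f).
Let D0 : 0 < D := rev_gt0 H.
Let fD : f D = 0 := profile_end d_gt1 hS H.
Let q := row_mx (const_mx (z D) : 'rV[R]_1) (0 : 'rV[R]_d).

Let rot_end th : P D th = q.
Proof. by rewrite /rot_coord fD scale0r. Qed.

Let DD : 0 <= D <= D. Proof. by rewrite lexx ltW. Qed.

Let in_cc s : 0 < s < D -> 0 <= s <= D.
Proof. by case/andP => /ltW -> /ltW ->. Qed.

Let near_inside : \forall s \near D^'-, 0 < s < D.
Proof.
by near=> s; apply/andP; split; near: s; [exact: nbhs_left_gt|exact: nbhs_left_lt].
Unshelve. all: by end_near. Qed.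

(** The tangent space at the second pole is orthogonal to the axis, since it contains the limits
    of the chords that join opposite points of a parallel. *)
Lemma second_pole_normal : exists2 n0 : R, n0 != 0 &
  forall e, 0 < e -> exists2 r, 0 < r & forall x y, Sigma x -> Sigma y ->
      `|x - q| < r -> `|y - q| < r ->
      `|dotp (row_mx (const_mx n0 : 'rV[R]_1) (0 : 'rV[R]_d)) (x - y)| <= e * `|x - y|.
Proof.
have [th0 th0S] : exists th : 'rV[R]_d, sphere th by apply: exists_sphere; exact: ltnW.
have Sq : Sigma q by rewrite -(rot_end th0); exact: (rot_in H).
have [nu [nu0 N _]] := embedded_sphere_normal hS Sq.
have [n0 [ny nuE]] := row_decomposition nu.
have k0 : const_mx 0 = 0 :> 'rV[R]_1 by apply/rowP => i; rewrite !mxE.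
have ny_sphere th : sphere th -> dotp ny th = 0.
  move=> thS; have nthS : sphere (- th).
    by rewrite /sphere/= -scaleN1r enormZ normrN1 mul1r.
  apply/eqP; rewrite -normr_le0; apply: (@ler0_eps _ _ 1) => // e e0; rewrite mulr1.
  have [r r0 rN] := N e e0.
  have n1 := rot_near H D r0 thS; have n2 := rot_near H D r0 nthS.
  have : \forall s \near D^'-, [/\ 0 < s < D, `|P s th - q| < r & `|P s (- th) - q| < r].
    near=> s; split; first by near: s.
      rewrite -(rot_end th); near: s; exact: cvg_within.
    rewrite -(rot_end (- th)); near: s; exact: cvg_within.
  move=> /filter_ex[s [sD s1 s2]].
  have := rN _ _ (rot_in H (in_cc sD) thS) (rot_in H (in_cc sD) nthS) s1 s2.
  have fs := rev_f_gt0 H sD.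
  have -> : P s th - P s (- th) = (2 * f s) *: row_mx (0 : 'rV[R]_1) th.
    rewrite /rot_coord opp_row_mx add_row_mx subrr scalerN opprK -scalerDl.
    by rewrite scale_row_mx scaler0 mulr2n mulrDl mul1r.
  rewrite nuE dotpZr dotp_row_mx dotp0r add0r.
  rewrite normrM [`|_ *: row_mx _ _|]normrZ [e * _]mulrCA ler_pM2l; last first.
    by rewrite normr_gt0 mulf_neq0// gt_eqF.
  move=> /le_trans; apply; apply: ler_piMr; first exact: ltW.
  apply: rV_norm_le => // i; rewrite -(splitK i); case: (fintype.split i) => j /=.
    by rewrite row_mxEl mxE normr0.
  by rewrite row_mxEr -(thS : enorm th = 1) coord_le_enorm.
have ny0 : ny = 0.
  apply/eqP; apply: contraT => nyn0.
  have := ny_sphere _ (sphere_normalize nyn0); rewrite dotpZr => /eqP.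
  by rewrite mulf_eq0 invr_eq0 enorm_eq0 dotp_eq0 orbb (negbTE nyn0).
exists n0; last by move: N; rewrite nuE ny0.
by apply: contra nu0 => /eqP n00; rewrite nuE ny0 n00 k0 row_mx0.
Unshelve. all: by end_near. Qed.

Lemma second_pole_flat e : 0 < e -> exists2 r, 0 < r & forall s t, 0 < s < D -> 0 < t < D ->
  D - r < s -> D - r < t -> `|z s - z t| <= e * `|s - t|.
Proof.
move=> e0; have [n0 n00 N] := second_pole_normal.
have [th thS] : exists th : 'rV[R]_d, sphere th by apply: exists_sphere; exact: ltnW.
have nn : 0 < `|n0| by rewrite normr_gt0.
have e1 : 0 < `|n0| * (e / 2) by rewrite mulr_gt0// divr_gt0.
have [r r0 rN] := N _ e1.
have /nbhs_ballP[r' /= r'0 r'P] := rot_near H D r0 thS.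
exists r' => // s t sD tD sr tr.
have near_q u : 0 < u < D -> D - r' < u -> `|P u th - q| < r.
  move=> /andP[u0 uD] ur; rewrite -(rot_end th); apply: r'P.
  rewrite -ball_normE/= gtr0_norm ?subr_gt0//; lra.
have := rN _ _ (rot_in H (in_cc sD) thS) (rot_in H (in_cc tD) thS) (near_q s sD sr) (near_q t tD tr).
rewrite dotpBr !dotp_rot !dotp0l !mulr0 !addr0 -mulrBr normrM -mulrA ler_pM2l//.
move=> /le_trans; apply.
rewrite -mulrA ler_pM2l// ler_pdivrMl//.
apply: le_trans (rot_dist _ _ thS) _; have := rev_z_lip H s t; have := rev_f_lip H s t; lra.
Qed.

Lemma second_pole_dz e : 0 < e -> \forall s \near D^'-, `|derive1 z s| <= e.
Proof.
move=> e0; have [r r0 rP] := second_pole_flat e0.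
near=> s.
have sD : 0 < s < D by near: s.
have sr : D - r < s by near: s; apply: nbhs_left_gt; rewrite ltrBlDr ltrDl.
have dz : is_derive s 1 z (derive1 z s).
  by rewrite derive1E; apply: derivableP; exact: (rev_dz H).
have C : `|h^-1 *: (z (s + h) - z s)| @[h --> 0^'] --> `|derive1 z s|.
  exact: cvg_norm (is_derive_cvg dz).
apply: (cvgr_to_le C).
have E : \forall h \near (0 : R), 0 < s + h < D /\ D - r < s + h.
  have c : s + h @[h --> (0 : R)] --> s.
    by rewrite -[X in _ --> X]addr0; apply: cvgD; [exact: cvg_cst|exact: cvg_id].
  have O : nbhs s [set t | 0 < t < D /\ D - r < t].
    move/andP : sD => [s0 sD]; near=> t.
    by split; [apply/andP; split|]; near: t; [exact: lt_nbhsr|exact: lt_nbhsl|exact: lt_nbhsr].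
  exact: c O.
have E2 : \forall h \near (0 : R), h != 0 -> `|h^-1 *: (z (s + h) - z s)| <= e.
  near=> h; move=> h0.
  have [hD hr] : 0 < s + h < D /\ D - r < s + h by near: h.
  rewrite normrZ normfV ler_pdivrMl ?normr_gt0// mulrC.
  by have := rP _ _ hD sD hr sr; rewrite (addrC s) addrK.
by rewrite near_withinE.
Unshelve. all: by end_near. Qed.

(** The radius decreases to [0], so the slope [-1] is the only possible one. *)
Lemma second_pole_df e : 0 < e -> \forall s \near D^'-, `|derive1 f s + 1| <= e.
Proof.
(* with e1 <= 1 / 2 the slope of f stays away from 0, hence keeps its sign *)
move=> e0; pose e1 := Num.min e (1 / 2).
have e10 : 0 < e1 by rewrite lt_min e0 divr_gt0.
have e1e : e1 <= e by rewrite ge_min lexx.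
have e12 : e1 <= 1 / 2 by rewrite ge_min lexx orbT.
have Z := second_pole_dz e10.
have [r r0 rP] : exists2 r, 0 < r & forall s, D - r < s < D -> 0 < s < D /\ `|derive1 z s| <= e1.
  have : \forall s \near D^'-, 0 < s < D /\ `|derive1 z s| <= e1.
    by near=> s; split; near: s.
  rewrite near_withinE => /nbhs_ballP[r /= r0 rP]; exists r => // s /andP[sr sD].
  apply: rP => //; rewrite -ball_normE/= gtr0_norm ?subr_gt0//; lra.
have f_sq s : D - r < s < D -> 1 - e1 <= derive1 f s ^+ 2 <= 1.
  move=> sr; have [sD zs] := rP s sr.
  have E := rev_arclength H sD.
  have z2 : derive1 z s ^+ 2 <= e1.
    rewrite -real_normK ?num_real// expr2.
    apply: (@le_trans _ _ (e1 * 1)); last by rewrite mulr1.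
    by apply: ler_pM => //; lra.
  by have := sqr_ge0 (derive1 z s); move=> ?; apply/andP; split; lra.
have f_ne s : D - r < s < D -> derive1 f s != 0.
  move=> /f_sq/andP[+ _]; apply: contraTneq => ->.
  by rewrite expr0n/= -ltNge; lra.
have f_neg s : D - r < s < D -> derive1 f s < 0.
  move=> sr; rewrite ltNge; apply/negP => f's.
  have [sD _] := rP s sr; have /andP[s0 sltD] := sD.
  have dfx x : x \in `]s, D[ -> is_derive x 1 f (derive1 f x).
    rewrite in_itv/= => /andP[sx xD]; rewrite derive1E; apply: derivableP.
    by apply: (rev_df H); rewrite xD (lt_trans s0).
  have cf : {within `[s, D], continuous f}.
    by apply: continuous_subspaceT; exact: lipschitz_continuous (rev_f_lip H).
  have [x + E] := MVT sltD dfx cf; rewrite in_itv/= => /andP[sx xD].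
  have f'x : derive1 f x < 0.
    have : derive1 f x * (D - s) < 0 by rewrite -E fD sub0r oppr_lt0 (rev_f_gt0 H).
    by rewrite pmulr_llt0// subr_gt0.
  have in_r y : s <= y <= x -> D - r < y < D.
    move=> /andP[sy yx]; case/andP: sr => sr _.
    by rewrite (lt_le_trans sr)//= (le_lt_trans yx).
  have cdf : {within `[s, x], continuous (derive1 f)}.
    apply: continuous_in_subspaceT => y /set_mem/=; rewrite in_itv/= => /in_r /rP[yD _].
    exact: (rev_cf H).
  have [|y] := @IVT _ _ _ _ 0 (ltW sx) cdf.
    by rewrite ge_min le_max f's (ltW f'x) orbT.
  rewrite in_itv/= => /in_r yr y0.
  by have := f_ne y yr; rewrite y0 eqxx.
have nr : \forall s \near D^'-, D - r < s < D.
  by near=> s; apply/andP; split; near: s;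
    [apply: nbhs_left_gt; rewrite ltrBlDr ltrDl|exact: nbhs_left_lt].
near=> s; have sr : D - r < s < D by near: s.
have /andP[f1 f2] := f_sq s sr; have f3 := f_neg s sr.
set y := derive1 f s in f1 f2 f3 *.
have y1 : - 1 <= y by nra.
rewrite ger0_norm; first by nra.
lra.
Unshelve. all: by end_near. Qed.

(** Otherwise two sheets of [Sigma] would meet at the pole, both tangent to the hyperplane
    orthogonal to the axis, and contain chords parallel to the axis. *)
Lemma poles_distinct : z D != z 0.
Proof.
apply/negP => /eqP zE; have [n0 n00 N] := second_pole_normal.
have [th thS] : exists th : 'rV[R]_d, sphere th by apply: exists_sphere; exact: ltnW.
have nn : 0 < `|n0| by rewrite normr_gt0.
have e1 : 0 < `|n0| / 2 by rewrite divr_gt0.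
have [r r0 rN] := N _ e1.
have rot0 : P 0 th = q by rewrite /rot_coord (rev_f0 H) scale0r -zE.
have /nbhs_ballP[a /= a0 aP] := rot_near H 0 r0 thS.
have /nbhs_ballP[b /= b0 bP] := rot_near H D r0 thS.
pose t1 := Num.min (a / 2) (D / 2).
have t10 : 0 < t1 by rewrite lt_min !divr_gt0.
have t1a : t1 <= a / 2 by rewrite ge_min lexx.
have t1D : t1 <= D / 2 by rewrite ge_min lexx orbT.
have ft1 : 0 < f t1 by apply: (rev_f_gt0 H); apply/andP; split; lra.
(* D - m is so close to D that its radius is also attained on [0, t1], near the first pole *)
pose m := Num.min (b / 2) (Num.min (D / 4) (f t1 / 2)).
have m0 : 0 < m by rewrite !lt_min !divr_gt0.
have mb : m <= b / 2 by rewrite ge_min lexx.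
have mD : m <= D / 4 by rewrite !ge_min lexx orbT.
have mf : m <= f t1 / 2 by rewrite !ge_min lexx !orbT.
have sD : 0 < D - m < D by apply/andP; split; lra.
have fs := rev_f_gt0 H sD.
have fs1 : f (D - m) <= m.
  have := le_trans (ler_norm _) (rev_f_lip H (D - m) D).
  rewrite fD subr0 (_ : D - m - D = - m); last by ring.
  by rewrite normrN gtr0_norm.
have cf : {within `[0, t1], continuous f}.
  by apply: continuous_subspaceT; exact: lipschitz_continuous (rev_f_lip H).
have [|t] := @IVT _ _ _ _ (f (D - m)) (ltW t10) cf.
  by rewrite (rev_f0 H) ge_min le_max (ltW fs) /=; apply/orP; right; lra.
rewrite in_itv/= => /andP[t0 tt1] ftE.
have tn0 : 0 < t.
  rewrite lt_neqAle t0 andbT; apply/eqP => t00.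
  by move: fs; rewrite -ftE -t00 (rev_f0 H) ltxx.
have tD : 0 < t < D by rewrite tn0/=; lra.
have sq : `|P (D - m) th - q| < r.
  rewrite -(rot_end th); apply: bP; rewrite -ball_normE/= opprB addrCA subrr addr0 gtr0_norm//.
  lra.
have tq : `|P t th - q| < r.
  rewrite -rot0; apply: aP; rewrite -ball_normE/= sub0r normrN gtr0_norm//; lra.
have := rN _ _ (rot_in H (in_cc sD) thS) (rot_in H (in_cc tD) thS) sq tq.
rewrite dotpBr !dotp_rot !dotp0l !mulr0 !addr0 -mulrBr normrM -mulrA ler_pM2l// => dz.
have : `|P (D - m) th - P t th| <= `|z (D - m) - z t| + `|f (D - m) - f t|.
  exact: rot_dist.
rewrite ftE subrr normr0 addr0 => dP.
have dz0 : z (D - m) - z t = 0.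
  apply/eqP; rewrite -normr_le0; lra.
have E : P (D - m) th = P t th by rewrite /rot_coord ftE (subr0_eq dz0).
have [sE _] := rev_inj H sD (in_cc tD) thS thS E; have := D0; lra.
Qed.

Lemma first_pole_profile : polar_profile D (z 0) f z.
Proof.
have cont (g : R -> R) : (forall s t, `|g s - g t| <= `|s - t|) -> g s @[s --> 0^'+] --> g 0.
  by move=> gL; apply: cvg_at_right_filter; exact: lipschitz_continuous.
split; [exact: D0|exact: (rev_df H)|exact: (rev_dz H)|exact: (rev_cf H)|exact: (rev_cz H)
  |exact: (rev_f_gt0 H)|exact: (rev_arclength H)| |exact: cont (rev_z_lip H)
  |exact: (rev_df0 H)|].
  by have := cont f (rev_f_lip H); rewrite (rev_f0 H).
have E : \forall s \near 0^'+, Num.sqrt (1 - derive1 f s ^+ 2) = `|derive1 z s|.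
  near=> s; have sD : 0 < s < D.
    by apply/andP; split; near: s; [exact: nbhs_right_gt|exact: nbhs_right_lt].
  by rewrite -(rev_arclength H sD) addrK sqrtr_sqr.
apply: norm_cvg0; apply: cvg_trans (near_eq_cvg E) _.
have C : derive1 f s * derive1 f s @[s --> 0^'+] --> (1 : R) * 1.
  by apply: cvgM; exact: (rev_df0 H).
have C1 : 1 - derive1 f s ^+ 2 @[s --> 0^'+] --> 1 - (1 : R) ^+ 2.
  by apply: cvgB; [exact: cvg_cst|exact: C].
have C2 : Num.sqrt (1 - derive1 f s ^+ 2) @[s --> 0^'+] --> Num.sqrt (1 - (1 : R) ^+ 2).
  exact: (@cvg_comp _ _ _ _ (@Num.sqrt R) _ _ _ C1 (@sqrt_continuous R _)).
by rewrite expr1n subrr sqrtr0 in C2.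
Unshelve. all: by end_near. Qed.

Lemma is_derive_reverse (g : R -> R) s : derivable g (D - s) 1 ->
  is_derive s 1 (fun t => g (D - t)) (- derive1 g (D - s)).
Proof.
move=> dg; have dc : is_derive s 1 (fun t : R => D - t) (- 1).
  by apply: is_derive_eq; rewrite add0r mul1r.
have dg1 : differentiable g (D - s) by exact/derivable1_diffP.
have := is_derive_comp_diff dc dg1.
by rewrite deriv1E// /GRing.scale/= mulN1r.
Qed.

Lemma second_pole_profile :
  polar_profile D (z D) (fun s => f (D - s)) (fun s => z (D - s)).
Proof.
have rev_in s : 0 < s < D -> 0 < D - s < D.
  by move=> /andP[s0 sD]; rewrite subr_gt0 sD ltrBlDr ltrDl.
have der (g : R -> R) : (forall s, 0 < s < D -> derivable g s 1) -> forall s, 0 < s < D ->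
    derivable (fun t => g (D - t)) s 1 /\ derive1 (fun t => g (D - t)) s = - derive1 g (D - s).
  move=> dg s sD; have Dg := is_derive_reverse (dg _ (rev_in s sD)).
  split; first exact: (@ex_derive _ _ _ _ _ _ _ Dg).
  by rewrite derive1E (@derive_val _ _ _ _ _ _ _ Dg).
have sub_cvg s : D - t @[t --> s] --> D - s by apply: cvgB; [exact: cvg_cst|exact: cvg_id].
have near_I s : 0 < s < D -> \forall t \near s, 0 < t < D.
  move=> /andP[s0 sD]; near=> t; apply/andP; split; near: t; [exact: lt_nbhsr|exact: lt_nbhsl].
have cder (g : R -> R) : (forall s, 0 < s < D -> derivable g s 1) ->
    (forall s, 0 < s < D -> {for s, continuous (derive1 g)}) -> forall s, 0 < s < D ->
    {for s, continuous (derive1 (fun t => g (D - t)))}.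
  move=> dg cg s sD; suff : derive1 (fun t => g (D - t)) t @[t --> s] -->
    derive1 (fun t => g (D - t)) s by [].
  rewrite (der g dg s sD).2.
  have E : \forall t \near s, - derive1 g (D - t) = derive1 (fun t => g (D - t)) t.
    near=> t; rewrite (der g dg t _).2//; near: t; exact: near_I.
  apply: cvg_trans (near_eq_cvg E) _; apply: cvgN.
  exact: (@cvg_comp _ _ _ (fun t => D - t) (derive1 g) _ _ _ (sub_cvg s) (cg _ (rev_in s sD))).
have lip_cvg (g : R -> R) : (forall s t, `|g s - g t| <= `|s - t|) ->
    g (D - s) @[s --> 0^'+] --> g D.
  move=> gL; have C : g (D - s) @[s --> (0 : R)] --> g (D - 0).
    have cg : {for D - 0, continuous g} by exact: lipschitz_continuous.
    exact: (@cvg_comp _ _ _ (fun t => D - t) g _ _ _ (sub_cvg 0) cg).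
  by rewrite subr0 in C; exact: cvg_at_right_filter.
have near0 : \forall s \near (0 : R)^'+, 0 < s < D.
  by near=> s; apply/andP; split; near: s; [exact: nbhs_right_gt|exact: nbhs_right_lt].
split; [exact: D0|by move=> s /(der f (rev_df H))[]|by move=> s /(der z (rev_dz H))[]
  |exact: cder (rev_df H) (rev_cf H)|exact: cder (rev_dz H) (rev_cz H)
  |by move=> s /rev_in; exact: (rev_f_gt0 H)| | |exact: lip_cvg (rev_z_lip H)| |].
- move=> s sD; rewrite (der f (rev_df H) s sD).2 (der z (rev_dz H) s sD).2 !sqrrN.
  exact/(rev_arclength H)/rev_in.
- by have := lip_cvg f (rev_f_lip H); rewrite fD.
- apply/cvgrPdist_le => e e0; have /nbhs_left0P N := second_pole_df e0.
  near=> s; have sD : 0 < s < D by near: s.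
  rewrite (der f (rev_df H) s sD).2 opprK addrC; near: s; exact: N.
- apply/cvgrPdist_le => e e0; have /nbhs_left0P N := second_pole_dz e0.
  near=> s; have sD : 0 < s < D by near: s.
  rewrite (der z (rev_dz H) s sD).2 opprK add0r; near: s; exact: N.
Unshelve. all: by end_near. Qed.

End TwoPoles.

(** * The distance between the poles *)

Section Length.
Context {R : realType}.

Lemma continuous_primitive (phi : R -> R) : continuous phi ->
  exists2 ell : R -> R, forall t : R, -1 < t < 2 -> is_derive t 1 ell (phi t) &
    (\int[@lebesgue_measure R]_(t in `[0%R, 1%R]) (phi t)%:E = (ell 1 - ell 0)%:E)%E.
Proof.
move=> cphi.
have cw a b : {within `[a, b], continuous phi} by exact: continuous_subspaceT.
pose ell (x : R) := (\int[@lebesgue_measure R]_(t in [set` `[-1, x]]) (phi t))%R.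
have int : (@lebesgue_measure R).-integrable `[-1, 2] (EFin \o phi).
  by apply: continuous_compact_integrable; [exact: segment_compact|exact: cw].
have dell (t : R) : -1 < t < 2 -> is_derive t 1 ell (phi t).
  move=> /andP[t1 t2].
  have [dl lE] := @continuous_FTC1_closed R phi (-1) t 2 t2 int t1 (cphi t).
  by apply: DeriveDef => //; rewrite -derive1E.
exists ell => //.
have dv (t : R) : -1 < t < 2 -> derivable ell t 1.
  by move=> /dell D; exact: (@ex_derive _ _ _ _ _ _ _ D).
have cont (t : R) : -1 < t < 2 -> {for t, continuous ell}.
  by move=> /dv D; apply: differentiable_continuous; exact/derivable1_diffP.
rewrite EFinB; apply: continuous_FTC2; [exact: ltr01|exact: cw| |].
  split.
  - by move=> t; rewrite in_itv/= => /andP[t0 t1]; apply: dv; apply/andP; split; lra.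
  - by apply: cvg_at_right_filter; apply: cont; apply/andP; split; lra.
  - by apply: cvg_at_left_filter; apply: cont; apply/andP; split; lra.
move=> t; rewrite in_itv/= => /andP[t0 t1].
have I : -1 < t < 2 by apply/andP; split; lra.
by have D := dell t I; rewrite derive1E (@derive_val _ _ _ _ _ _ _ D).
Qed.

Lemma cvg_is_derive (g : R -> R) (t l : R) :
  h^-1 * (g (t + h) - g t) @[h --> 0^'] --> l -> is_derive t 1 g l.
Proof.
move=> C.
have E : (fun h : R => h^-1 *: (g (h%:A + t) - g t)) = (fun h => h^-1 * (g (t + h) - g t)).
  by apply/funext => h; rewrite [_%:A]mulr1 (addrC h).
apply: DeriveDef; first by apply/cvg_ex; exists l; rewrite /= E.
by rewrite /derive /= E; exact: cvg_lim.
Qed.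

End Length.

Section PoleDistance.
Context {R : realType} {d : nat} {Sigma : set 'rV[R]_(1 + d)} {D : R} {f z : R -> R}.
Hypothesis d_gt1 : (1 < d)%N.
Hypothesis hS : embedded_sphere Sigma.
Hypothesis H : hypersurface_of_revolution Sigma D f z.
Local Notation P := (@rot_coord R d z f).
Let D0 : 0 < D := rev_gt0 H.
Let fD : f D = 0 := profile_end d_gt1 hS H.

Lemma profile_injective (th : 'rV[R]_d) s t : sphere th -> 0 <= s <= D -> 0 <= t <= D ->
  P s th = P t th -> s = t.
Proof.
move=> thS sD tD E.
have [sI|sn] := boolP (0 < s < D); first by have [] := rev_inj H sI tD thS thS E.
have [tI|tn] := boolP (0 < t < D); first by have [] := rev_inj H tI sD thS thS (esym E).
have ends u : 0 <= u <= D -> ~~ (0 < u < D) -> u = 0 \/ u = D.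
  move=> /andP[u0 uD]; rewrite negb_and -!leNgt => /orP[u0'|uD'].
    by left; apply/eqP; rewrite eq_le u0'.
  by right; apply/eqP; rewrite eq_le uD.
have zE : z s = z t.
  by move: E => /eq_row_mx[/matrixP/(_ 0 0)]; rewrite !mxE.
have /eqP zz := poles_distinct d_gt1 hS H.
by case: (ends s sD sn) zE => ->; case: (ends t tD tn) => -> // E'; case: zz.
Qed.

(** [sig t] is the distance to the first pole of the point at time [t]. *)
Variables (c : R -> 'rV[R]_(1 + d)) (sig : R -> R).
Hypothesis dc : forall t : R, derivable c t 1.
Hypothesis cdc : continuous (derive1 c).
Hypothesis sigP : forall t, 0 <= t <= 1 ->
  exists2 th : 'rV[R]_d, sphere th & 0 <= sig t <= D /\ c t = P (sig t) th.

Let height t := c t 0 (lshift d 0).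
Let radius t := enorm (rsubmx (c t)).

Let heightE t : 0 <= t <= 1 -> height t = z (sig t).
Proof. by move=> /sigP[th thS [sD cE]]; rewrite /height cE row_mxEl mxE. Qed.

Let radiusE t : 0 <= t <= 1 -> radius t = f (sig t).
Proof.
move=> /sigP[th thS [sD cE]]; rewrite /radius cE row_mxKr enormZ (thS : enorm th = 1).
by rewrite mulr1 ger0_norm// (rev_f_ge0 H).
Qed.

Let is_derive_c (t : R) : is_derive t 1 c (derive1 c t).
Proof. by rewrite derive1E; exact: derivableP. Qed.

Let is_derive_height (t : R) : is_derive t 1 height (derive1 c t 0 (lshift d 0)).
Proof. exact: (is_derive_rV _ _ _).1 (is_derive_c t) _. Qed.

Let is_derive_rsub (t : R) : is_derive t 1 (fun u => rsubmx (c u)) (rsubmx (derive1 c t)).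
Proof.
apply/is_derive_rV => j; rewrite mxE.
have -> : (fun u => rsubmx (c u) 0 j) = (fun u => c u 0 (rshift 1 j)).
  by apply/funext => u; rewrite mxE.
exact: (is_derive_rV _ _ _).1 (is_derive_c t) _.
Qed.

Let continuous_radius : continuous radius.
Proof.
move=> t; apply: (@continuous_comp _ _ _ (fun u => rsubmx (c u)) (@enorm R d)).
  exact: is_derive_continuous (is_derive_rsub t).
exact: continuous_enorm.
Qed.

Let continuous_height : continuous height.
Proof. by move=> t; exact: is_derive_continuous (is_derive_height t). Qed.

(** The height and the radius determine the parameter, and do so continuously by
    compactness of [[0, D]]. *)
Lemma sig_continuous (t0 e : R) : 0 <= t0 <= 1 -> 0 < e ->
  \forall t \near t0, 0 <= t <= 1 -> `|sig t - sig t0| < e.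
Proof.
move=> t01 e0.
have [th thS] : exists th : 'rV[R]_d, sphere th by apply: exists_sphere; exact: ltnW.
have sD t : 0 <= t <= 1 -> 0 <= sig t <= D by move=> /sigP[? _ []].
have hV : hausdorff_space 'rV[R]_(1 + d) by exact: norm_hausdorff.
have cP : {within `[0, D], continuous (P ^~ th)}.
  apply: continuous_subspaceT => s; apply: cvg_row_mx_scale.
    exact: lipschitz_continuous (rev_z_lip H) s.
  exact: lipschitz_continuous (rev_f_lip H) s.
have inj s : `[0, D]%classic s -> P s th = P (sig t0) th -> s = sig t0.
  by rewrite /= in_itv/= => sD'; apply: profile_injective => //; exact: sD.
have Q := compact_near_preimage hV (@segment_compact R 0 D) cP inj (nbhsx_ballx (sig t0) e e0).
pose g t : 'rV[R]_(1 + d) := row_mx (const_mx (height t) : 'rV[R]_1) (radius t *: th).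
have gE t : 0 <= t <= 1 -> g t = P (sig t) th.
  by move=> t1; rewrite /g heightE// radiusE.
have cg : g t @[t --> t0] --> P (sig t0) th.
  rewrite -gE//; apply: cvg_row_mx_scale; [exact: continuous_height|exact: continuous_radius].
have {}Q : \forall t \near t0,
    forall s, `[0, D]%classic s -> P s th = g t -> ball (sig t0) e s by exact: cg Q.
near=> t; move=> t1.
have Qt : forall s, `[0, D]%classic s -> P s th = g t -> ball (sig t0) e s by near: t.
have := Qt (sig t); rewrite /= in_itv/= sD// gE// => /(_ isT erefl).
by rewrite -ball_normE/= distrC.
Unshelve. all: by end_near. Qed.

Let dsig t := derive1 f (sig t) * (dotp (rsubmx (c t)) (rsubmx (derive1 c t)) / radius t) +
    derive1 z (sig t) * derive1 c t 0 (lshift d 0).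

(** As the profile has unit speed, the combination [A] of the difference quotients of [f] and [z]
    tends to [1] at [s0]; dividing by it yields the derivative of [sig] without
    inverting [f] or [z]. *)
Lemma is_derive_sig (t : R) : 0 < t < 1 -> 0 < sig t < D -> is_derive t 1 sig (dsig t).
Proof.
move=> t01 sI; set s0 := sig t.
have t01' : 0 <= t <= 1 by case/andP: t01 => /ltW -> /ltW ->.
have rt : radius t = f s0 by rewrite radiusE.
have fs := rev_f_gt0 H sI; rewrite -/s0 in fs.
have y0 : rsubmx (c t) != 0 by rewrite -enorm_gt0; rewrite /radius in rt; rewrite rt.
have drad : is_derive t 1 radius (dotp (rsubmx (c t)) (rsubmx (derive1 c t)) / radius t).
  have dE := is_diff_enorm y0.
  have := is_derive_comp_diff (is_derive_rsub t) (@ex_diff _ _ _ _ _ _ _ dE).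
  by rewrite (@diff_val _ _ _ _ _ _ _ dE).
apply: cvg_is_derive.
pose A s := if s == s0 then 1 else
  derive1 f s0 * ((s - s0)^-1 * (f s - f s0)) + derive1 z s0 * ((s - s0)^-1 * (z s - z s0)).
have AE s : A s * (s - s0) = derive1 f s0 * (f s - f s0) + derive1 z s0 * (z s - z s0).
  rewrite /A; case: eqVneq => [->|ss0]; first by rewrite !subrr !mulr0 addr0.
  by field; rewrite subr_eq0.
have cA : A s @[s --> s0] --> (1 : R).
  have df0 : is_derive s0 1 f (derive1 f s0).
    by rewrite derive1E; apply: derivableP; exact: (rev_df H).
  have dz0 : is_derive s0 1 z (derive1 z s0).
    by rewrite derive1E; apply: derivableP; exact: (rev_dz H).
  have C : derive1 f s0 * (h^-1 * (f (s0 + h) - f s0)) +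
      derive1 z s0 * (h^-1 * (z (s0 + h) - z s0)) @[h --> 0^'] --> (1 : R).
    rewrite -(rev_arclength H sI) -/s0 addrC !expr2; apply: cvgD; apply: cvgM; try exact: cvg_cst.
      exact: is_derive_cvg df0.
    exact: is_derive_cvg dz0.
  apply/cvgrPdist_le => e e0.
  move/cvgrPdist_le : C => /(_ e e0) C1.
  have /nbhs_ballP[r /= r0 rP] : \forall h \near (0 : R), h != 0 ->
      `|1 - (derive1 f s0 * (h^-1 * (f (s0 + h) - f s0)) +
        derive1 z s0 * (h^-1 * (z (s0 + h) - z s0)))| <= e.
    by move: C1; rewrite near_withinE.
  near=> s; rewrite /A; case: eqVneq => [_|ss0]; first by rewrite subrr normr0 ltW.
  have sr : ball s0 r s by near: s; exact: (nbhsx_ballx s0 r r0).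
  have := rP (s - s0); rewrite (addrC s0) subrK; apply; last by rewrite subr_eq0.
  by move: sr; rewrite -!ball_normE/= sub0r normrN distrC.
have csig : sig (t + h) @[h --> 0^'] --> s0.
  apply/cvgrPdist_lt => e e0; have N := sig_continuous t01' e0.
  have tc : t + h @[h --> (0 : R)] --> t.
    by rewrite -[X in _ --> X]addr0; apply: cvgD; [exact: cvg_cst|exact: cvg_id].
  have O : nbhs t [set u | 0 <= u <= 1].
    by move/andP : t01 => [t0 t1]; near=> u; apply/andP; split; apply: ltW; near: u;
      [exact: lt_nbhsr|exact: lt_nbhsl].
  have {}N : \forall u \near t, `|s0 - sig u| < e.
    near=> u; rewrite distrC.
    have ui : 0 <= u <= 1 by near: u.
    by move: ui; near: u.
  have : \forall h \near (0 : R), `|s0 - sig (t + h)| < e by exact: tc N.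
  by rewrite near_withinE; apply: filterS => h hh _.
have cAs : A (sig (t + h)) @[h --> 0^'] --> (1 : R).
  exact: (@cvg_comp _ _ _ (fun h => sig (t + h)) A _ _ _ csig cA).
have cN : (derive1 f s0 * (h^-1 * (radius (t + h) - radius t)) +
    derive1 z s0 * (h^-1 * (height (t + h) - height t))) / A (sig (t + h))
    @[h --> 0^'] --> dsig t / 1.
  apply: cvgM; last by apply: cvgV => //; exact: oner_neq0.
  apply: cvgD; apply: cvgM; try exact: cvg_cst.
    exact: is_derive_cvg drad.
  exact: is_derive_cvg (is_derive_height t).
rewrite divr1 in cN; apply: cvg_trans cN; apply: near_eq_cvg.
have A0 : \forall h \near 0^', 0 < A (sig (t + h)) by apply: (cvgr_gt _ cAs); exact: ltr01.
have inI : \forall h \near 0^', 0 <= t + h <= 1.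
  have tc : t + h @[h --> (0 : R)] --> t.
    by rewrite -[X in _ --> X]addr0; apply: cvgD; [exact: cvg_cst|exact: cvg_id].
  have O : nbhs t [set u | 0 <= u <= 1].
    by move/andP : t01 => [t0 t1]; near=> u; apply/andP; split; apply: ltW; near: u;
      [exact: lt_nbhsr|exact: lt_nbhsl].
  have : \forall h \near (0 : R), 0 <= t + h <= 1 by exact: tc O.
  by rewrite near_withinE; apply: filterS => h hh _.
near=> h.
have Ah : A (sig (t + h)) != 0 by rewrite gt_eqF//; near: h.
have hI : 0 <= t + h <= 1 by near: h.
rewrite !radiusE// !heightE// -/s0.
have := AE (sig (t + h)); move: (A _) Ah => a a0 E.
rewrite [_ * (h^-1 * _)]mulrCA [X in _ + X]mulrCA -mulrDr -E; field.
by rewrite a0 andbT; near: h; exact: nbhs_dnbhs_neq.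
Unshelve. all: by end_near. Qed.

(** The Cauchy-Schwarz inequality, once for the profile and once for the radial part of the
    velocity. *)
Lemma dsig_le (t : R) : 0 < t < 1 -> 0 < sig t < D -> dsig t <= enorm (derive1 c t).
Proof.
move=> t01 sI; have t01' : 0 <= t <= 1 by case/andP: t01 => /ltW -> /ltW ->.
rewrite /dsig; have rt : 0 < radius t by rewrite radiusE// (rev_f_gt0 H).
have arc := rev_arclength H sI.
set y := rsubmx (c t); set y' := rsubmx (derive1 c t); set u := derive1 c t 0 (lshift d 0).
have cE : dotp (derive1 c t) (derive1 c t) = u ^+ 2 + dotp y' y'.
  have [a [v E]] := row_decomposition (derive1 c t).
  by rewrite /u /y' E row_mxKr row_mxEl mxE dotp_row_mx dotp_const expr2.
have r2 : (dotp y y' / radius t) ^+ 2 <= dotp y' y'.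
  rewrite expr_div_n ler_pdivrMr ?exprn_gt0// /radius sqr_enorm mulrC; exact: dotp_CS.
move: (derive1 f _) (derive1 z _) arc (dotp y y' / _) r2 => f' z' arc rho r2.
have [v0|v0] := leP (f' * rho + z' * u) 0; first exact: le_trans v0 (enorm_ge0 _).
rewrite -ler_sqr ?nnegrE ?enorm_ge0 ?(ltW v0)// sqr_enorm cE.
apply: (@le_trans _ _ ((z' ^+ 2 + f' ^+ 2) * (u ^+ 2 + rho ^+ 2))).
  have := sqr_ge0 (f' * u - z' * rho); rewrite -subr_ge0 => h.
  rewrite -subr_ge0; apply: le_trans h _.
  by rewrite le_eqVlt; apply/orP; left; apply/eqP; ring.
by rewrite arc mul1r lerD2l.
Qed.

(** Between the last time at the first pole and the next time at the second one, the curve stays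
    where [sig] is differentiable, and there [sig] grows at most as fast as the arc
    length [ell]. *)
Lemma profile_length :
  c 0 = row_mx (const_mx (z 0) : 'rV[R]_1) 0 -> c 1 = row_mx (const_mx (z D) : 'rV[R]_1) 0 ->
  (D%:E <= curve_length c)%E.
Proof.
move=> c0 c1.
have rot_pole s (th : 'rV[R]_d) : f s = 0 -> P s th = row_mx (const_mx (z s) : 'rV[R]_1) 0.
  by move=> fs; rewrite /rot_coord fs scale0r.
have DD : 0 <= D <= D by rewrite lexx ltW.
have OO : 0 <= (0 : R) <= D by rewrite lexx ltW.
have cc : continuous c by move=> t; exact: is_derive_continuous (is_derive_c t).
have cphi : continuous (fun t => enorm (derive1 c t)).
  by move=> t; apply: (@continuous_comp _ _ _ (derive1 c) (@enorm R d.+1));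
    [exact: cdc|exact: continuous_enorm].
have [ell dell ellE] := continuous_primitive cphi; rewrite /curve_length ellE.
rewrite lee_fin.
have sig_eq (t s : R) : 0 <= t <= 1 -> 0 <= s <= D -> f s = 0 ->
    c t = row_mx (const_mx (z s) : 'rV[R]_1) 0 -> sig t = s.
  move=> t01 sD fs ct; have [th thS [tD cE]] := sigP t01.
  by apply: (profile_injective thS tD sD); rewrite -cE ct rot_pole.
have eq_sig (t s : R) : 0 <= t <= 1 -> sig t = s -> f s = 0 ->
    c t = row_mx (const_mx (z s) : 'rV[R]_1) 0.
  move=> t01 ts fs; have [th thS [tD ->]] := sigP t01.
  by rewrite ts rot_pole.
have closed_fiber (q : 'rV[R]_(1 + d)) (a b : R) : compact (`[a, b] `&` [set t | c t = q]).
  apply: compact_closedI; first exact: segment_compact.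
  apply: (@closed_comp _ _ c [set q]); first by move=> x _; exact: cc.
  exact: (compact_closed (@norm_hausdorff _ _) (@compact_set1 _ q)).
have [t1 /set_mem[/= + ct1] t1max] : exists2 t1,
    t1 \in `[0, 1] `&` [set t | c t = row_mx (const_mx (z 0) : 'rV[R]_1) 0] &
    forall t, t \in `[0, 1] `&` [set t | c t = row_mx (const_mx (z 0) : 'rV[R]_1) 0] -> t <= t1.
  apply: (@compact_EVT_max _ _ id) => //.
    by exists 0; split => //=; rewrite in_itv/= lexx ler01.
  by apply: continuous_subspaceT => t; exact: cvg_id.
rewrite in_itv/= => /andP[t10 t11].
have [t2 /set_mem[/= + ct2] t2min] : exists2 t2,
    t2 \in `[t1, 1] `&` [set t | c t = row_mx (const_mx (z D) : 'rV[R]_1) 0] &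
    forall t, t \in `[t1, 1] `&` [set t | c t = row_mx (const_mx (z D) : 'rV[R]_1) 0] -> t2 <= t.
  apply: (@compact_EVT_min _ _ id) => //.
    by exists 1; split => //=; rewrite in_itv/= t11 lexx.
  by apply: continuous_subspaceT => t; exact: cvg_id.
rewrite in_itv/= => /andP[t12 t21].
have st1 : sig t1 = 0 by apply: sig_eq => //; [rewrite t10|exact: (rev_f0 H)].
have st2 : sig t2 = D by apply: sig_eq => //; rewrite (le_trans t10).
have inside (t : R) : t1 < t < t2 -> 0 < t < 1 /\ 0 < sig t < D.
  move=> /andP[tt1 tt2]; have t01 : 0 < t < 1.
    by rewrite (le_lt_trans t10)//= (lt_le_trans tt2).
  have t01' : 0 <= t <= 1 by case/andP: t01 => /ltW -> /ltW ->.
  split => //; have [th thS [/andP[s0 sD] _]] := sigP t01'.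
  rewrite !lt_neqAle s0 sD !andbT; apply/andP; split.
    apply/negP => /eqP s00; have := eq_sig t 0 t01' (esym s00) (rev_f0 H) => ct.
    have := t1max t; rewrite inE /= in_itv/= => /(_ (conj t01' ct)).
    by rewrite leNgt tt1.
  apply/negP => /eqP sDD; have := eq_sig t D t01' sDD fD => ct.
  have tI : t1 <= t <= 1 by rewrite ltW//; case/andP: t01'.
  have := t2min t; rewrite inE /= in_itv/= => /(_ (conj tI ct)).
  by rewrite leNgt tt2.
have dellt (t : R) : 0 <= t <= 1 -> is_derive t 1 ell (enorm (derive1 c t)).
  by move=> /andP[t0 t1']; apply: dell; apply/andP; split; lra.
have cell (t : R) : 0 <= t <= 1 -> {for t, continuous ell}.
  by move=> /dellt; exact: is_derive_continuous.
have mono (a b : R) : 0 <= a -> a <= b -> b <= 1 -> ell a <= ell b.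
  move=> a0 ab b1.
  have I t : a <= t <= b -> 0 <= t <= 1.
    by move=> /andP[at_ tb]; rewrite (le_trans a0)//= (le_trans tb).
  have dI (t : R) : t \in `]a, b[ -> is_derive t 1 ell (enorm (derive1 c t)).
    by rewrite in_itv/= => /andP[at_ tb]; apply/dellt/I; rewrite !ltW.
  apply: (@ger0_derive1_le_cc _ ell a b); rewrite ?in_itv/= ?lexx ?ab//.
  - by move=> t /dI D1; exact: (@ex_derive _ _ _ _ _ _ _ D1).
  - by move=> t /dI D1; rewrite derive1E (@derive_val _ _ _ _ _ _ _ D1) enorm_ge0.
  - apply: continuous_in_subspaceT => t /set_mem/=; rewrite in_itv/= => /I; exact: cell.
have I12 t : t1 <= t <= t2 -> 0 <= t <= 1.
  by move=> /andP[a b]; rewrite (le_trans t10)//= (le_trans b).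
have main : ell t1 - sig t1 <= ell t2 - sig t2.
  have dh (t : R) : t \in `]t1, t2[ -> is_derive t 1 (fun t => ell t - sig t)
      (enorm (derive1 c t) - dsig t).
    rewrite in_itv/= => tI; have [t01 sI] := inside t tI.
    have D1 := is_derive_sig t01 sI.
    have tI' : t1 <= t <= t2 by case/andP: tI => /ltW -> /ltW ->.
    exact: (is_deriveB (dellt t (I12 t tI')) D1).
  apply: (@ger0_derive1_le_cc _ (fun t => ell t - sig t) t1 t2);
    rewrite ?in_itv/= ?lexx ?t12//.
  - by move=> t /dh D1; exact: (@ex_derive _ _ _ _ _ _ _ D1).
  - move=> t tI; have D1 := dh t tI; rewrite derive1E (@derive_val _ _ _ _ _ _ _ D1) subr_ge0.
    by move: tI; rewrite in_itv/= => /inside[t01 sI]; exact: dsig_le.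
  - apply/subspace_continuousP => t /=; rewrite in_itv/= => tI.
    have tI' := I12 t tI; apply: cvgB.
      by apply: cvg_within_filter; exact: cell.
    apply/cvgrPdist_lt => e e0; rewrite near_withinE.
    have N := sig_continuous tI' e0.
    near=> u; rewrite /= in_itv/= => /I12; rewrite distrC; near: u; exact: N.
have := mono 0 t1 (lexx 0) t10 t11.
have := mono t2 1 (le_trans t10 t12) t21 (lexx 1).
by move: main; rewrite st1 st2; lra.
Unshelve. all: by end_near. Qed.

End PoleDistance.

(** * The area bound *)

Lemma polar_profile_sub (R : realType) (a b z0 : R) (f z : R -> R) :
  0 < b -> b <= a -> polar_profile a z0 f z -> polar_profile b z0 f z.
Proof.
move=> b0 ba [_ df dz cf cz f0 arc lf lz ldf ldz].
have I s : 0 < s < b -> 0 < s < a by move=> /andP[-> /lt_le_trans]; apply.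
by split => // s /I; [exact: df|exact: dz|exact: cf|exact: cz|exact: f0|exact: arc].
Qed.

Section Area.
Context {R : realType} {d : nat} {Sigma : set 'rV[R]_(1 + d)} {D : R} {f z : R -> R}.
Hypothesis d_gt1 : (1 < d)%N.
Hypothesis hS : embedded_sphere Sigma.
Hypothesis H : hypersurface_of_revolution Sigma D f z.
Local Notation P := (@rot_coord R d z f).
Let D0 : 0 < D := rev_gt0 H.
Let fD : f D = 0 := profile_end d_gt1 hS H.

Let cap1 a := @polar_cap R a (z 0) f z d.
Let cap2 a := @polar_cap R a (z D) (fun s => f (D - s)) (fun s => z (D - s)) d.

Let cover a : D / 2 < a -> Sigma `<=` cap1 a `|` cap2 a.
Proof.
move=> Da x; rewrite (rev_image H) => -[s [th [/andP[s0 sD] thS ->]]].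
have enormE t : 0 <= t -> enorm (t *: th) = t.
  by move=> t0; rewrite enormZ (thS : enorm th = 1) mulr1 ger0_norm.
have [sa|sa] := ltP s a.
  left; exists (s *: th); first by rewrite /= enormE.
  move: s0; rewrite le_eqVlt => /predU1P[<-|s0]; last exact: polar_chartE.
  by rewrite scale0r polar_chart0 /rot_coord (rev_f0 H) scale0r.
right; exists ((D - s) *: th); first by rewrite /= enormE ?subr_ge0//; lra.
move: sD; rewrite le_eqVlt => /predU1P[->|sD].
  by rewrite subrr scale0r polar_chart0 /rot_coord fD scale0r.
by rewrite polar_chartE ?subr_gt0// /rot_coord opprB addrCA subrr addr0.
Qed.

(** Open caps of radius larger than [D / 2] around the two poles cover [Sigma], including the
    parallel at equal distance of the poles. *)
Lemma area_le_caps (vol : {measure set (borel_rV R (1 + d)) -> \bar R}) a :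
  riemannian_volume d Sigma vol -> D / 2 < a -> a <= D ->
  (vol Sigma <= (2 * a ^+ d)%:E * ball_volume R d)%E.
Proof.
move=> hvol Da aD; have d_gt0 : (0 < d)%N by exact: ltnW.
have a0 : 0 < a by apply: lt_trans Da; rewrite divr_gt0.
have I s : 0 < s < a -> 0 < s < D by move=> /andP[-> /lt_le_trans]; apply.
have I2 s : 0 < s < D -> 0 <= s <= D by move=> /andP[/ltW -> /ltW ->].
have J s : 0 < s < D -> 0 < D - s < D.
  by move=> /andP[s0 sD]; rewrite subr_gt0 sD ltrBlDr ltrDl.
have OO : 0 <= (0 : R) <= D by rewrite lexx ltW.
have DD : 0 <= D <= D by rewrite lexx ltW.
have [th0 th0S] : exists th : 'rV[R]_d, sphere th by exact: exists_sphere.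
have prof1 := polar_profile_sub a0 aD (first_pole_profile H).
have prof2 := polar_profile_sub a0 aD (second_pole_profile d_gt1 hS H).
have pole1 : Sigma (row_mx (const_mx (z 0) : 'rV[R]_1) 0).
  by have := rot_in H OO th0S; rewrite /rot_coord (rev_f0 H) scale0r.
have pole2 : Sigma (row_mx (const_mx (z D) : 'rV[R]_1) 0).
  by have := rot_in H DD th0S; rewrite /rot_coord fD scale0r.
have V1 : (vol (cap1 a) <= (a ^+ d)%:E * ball_volume R d)%E.
  apply: (polar_cap_volume prof1 _ pole1 _ d_gt0 hvol).
    by move=> s th /I/I2; exact: (rot_in H).
  by move=> s1 s2 th1 th2 /I s1I /I/I2 s2I; exact: (rev_inj H).
have V2 : (vol (cap2 a) <= (a ^+ d)%:E * ball_volume R d)%E.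
  apply: (polar_cap_volume prof2 _ pole2 _ d_gt0 hvol).
    by move=> s th /I/J/I2; exact: (rot_in H).
  move=> s1 s2 th1 th2 /I/J s1I /I/J/I2 s2I th1S th2S E.
  by have [/addrI/oppr_inj ->] := rev_inj H s1I s2I th1S th2S E.
have m1 : measurable (cap1 a : set (borel_rV R (1 + d))) by exact: measurable_polar_cap prof1.
have m2 : measurable (cap2 a : set (borel_rV R (1 + d))) by exact: measurable_polar_cap prof2.
have mS : measurable (Sigma : set (borel_rV R (1 + d))).
  apply: closed_borel_measurable; apply: compact_closed; first exact: norm_hausdorff.
  exact: embedded_sphere_compact.
have m12 : measurable (cap1 a `|` cap2 a : set (borel_rV R (1 + d))) by exact: measurableU.
apply: (@le_trans _ _ (vol (cap1 a `|` cap2 a))).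
  by apply: le_measure; rewrite ?inE//; exact: cover.
have U2 : (vol (cap1 a `|` cap2 a) <= vol (cap1 a) + vol (cap2 a))%E by exact: measureU2.
apply: le_trans U2 _; apply: le_trans (leeD V1 V2) _.
have ad : (0 <= (a ^+ d)%:E)%E by rewrite lee_fin exprn_ge0// ltW.
have -> : 2 * a ^+ d = a ^+ d + a ^+ d by ring.
by rewrite EFinD ge0_muleDl.
Qed.

(** Let the radius of the caps decrease to [D / 2]. *)
Lemma area_le (vol : {measure set (borel_rV R (1 + d)) -> \bar R}) (b : R) :
  riemannian_volume d Sigma vol -> ball_volume R d = b%:E ->
  (vol Sigma <= (2 * (D / 2) ^+ d * b)%:E)%E.
Proof.
move=> hvol bE.
have V a : D / 2 < a -> a <= D -> (vol Sigma <= (2 * a ^+ d * b)%:E)%E.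
  by move=> Da aD; have := area_le_caps hvol Da aD; rewrite bE.
have D2 : D / 2 < D by have := D0; lra.
have v_fin : vol Sigma \is a fin_num.
  rewrite ge0_fin_numE; last exact: measure_ge0.
  by apply: le_lt_trans (V D D2 (lexx D)) _; exact: ltry.
move: V; rewrite -(fineK v_fin); move: (fine _) => v V; rewrite lee_fin.
have C : 2 * a ^+ d * b @[a --> (D / 2)^'+] --> 2 * (D / 2) ^+ d * b.
  apply: cvg_at_right_filter; apply: cvgM; last exact: cvg_cst.
  apply: cvgM; first exact: cvg_cst.
  exact: exprn_continuous.
apply: (cvgr_to_ge C); near=> a; rewrite -lee_fin; apply: V.
  by near: a; exact: nbhs_right_gt.
by near: a; exact: nbhs_right_le.
Unshelve. all: by end_near. Qed.

Lemma pole_distance_le :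
  (D%:E <= geodesic_dist Sigma (row_mx (const_mx (z 0) : 'rV[R]_1) 0)
                               (row_mx (const_mx (z D) : 'rV[R]_1) 0))%E.
Proof.
apply: le_ereal_inf_tmp => _ [c [dc cdc [c0 c1] cS] <-].
have ex t : exists s, 0 <= t <= 1 ->
    exists2 th : 'rV[R]_d, sphere th & 0 <= s <= D /\ c t = P s th.
  have [t01|nt] := boolP (0 <= t <= 1); last by exists 0.
  have := cS t t01; rewrite (rev_image H) => -[s [th [sD thS cE]]].
  by exists s => _; exists th.
have [sig sigP] := choice ex.
exact: (profile_length d_gt1 hS H dc cdc sigP).
Qed.

End Area.

Theorem theorem3 (R : realType) (d : nat) (hd : (2 <= d)%N)
  (Sigma : set 'rV[R]_(1 + d))
  (hSigma : embedded_sphere Sigma)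
  (hsym : spherically_symmetric Sigma)
  (vol : {measure set (borel_rV R (1 + d)) -> \bar R})
  (hvol : riemannian_volume d Sigma vol)
  (D : R) (hD : is_diameter Sigma D) :
  (vol Sigma * ((D ^+ d)^-1)%:E <= ball_volume R d * ((2 ^+ (d - 1))^-1)%:E)%E.
Proof.
have [p [L [f0 [k [z0 G]]]]] := hsym.
have clS : closed Sigma.
  by apply: compact_closed; [exact: norm_hausdorff|exact: embedded_sphere_compact].
have [f [z H]] := gsc_revolution (ltnW hd) clS G.
have L0 := rev_gt0 H.
have [th0 th0S] := @exists_sphere R d (ltnW hd).
have pole s : 0 <= s <= L -> f s = 0 -> Sigma (row_mx (const_mx (z s) : 'rV[R]_1) 0).
  by move=> sL fs; have := rot_in H sL th0S; rewrite /rot_coord fs scale0r.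
have OO : 0 <= (0 : R) <= L by rewrite lexx ltW.
have LL : 0 <= L <= L by rewrite lexx ltW.
have LD : L <= D.
  rewrite -lee_fin; apply: le_trans (pole_distance_le hd hSigma H) _.
  apply: hD.2; first exact: pole OO (rev_f0 H).
  exact: pole LL (profile_end hd hSigma H).
have D_gt0 : 0 < D by exact: lt_le_trans LD.
have Dd0 : 0 < D ^+ d by rewrite exprn_gt0.
have p2 : 0 < (2 ^+ (d - 1) : R)^-1 by rewrite invr_gt0 exprn_gt0.
have b0 : (0 <= ball_volume R d)%E by rewrite ball_volumeE ball_volume2_ge0.
have [bfin|] := boolP (ball_volume R d \is a fin_num); last first.
  rewrite ge0_fin_numE// -leNgt leye_eq => /eqP ->.
  by rewrite gt0_mulye ?lte_fin// leey.
have bE : ball_volume R d = (fine (ball_volume R d))%:E by rewrite fineK.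
have fb0 : 0 <= fine (ball_volume R d) by rewrite fine_ge0.
have A := area_le hd hSigma H hvol bE; move: bE fb0 A; move: (fine _) => b -> fb0 A.
have iD : (0 <= ((D ^+ d)^-1)%:E)%E by rewrite lee_fin invr_ge0 ltW.
apply: le_trans (lee_wpmul2r iD A) _.
rewrite -!EFinM lee_fin ler_pdivrMr//.
have LDd : L ^+ d <= D ^+ d by apply: lerXn2r => //; rewrite nnegrE ltW.
have -> : 2 * (L / 2) ^+ d * b = b / 2 ^+ (d - 1) * L ^+ d.
  have E : 2 ^+ d = 2 * 2 ^+ (d - 1) :> R by rewrite -[LHS]/(2 ^+ d) -{1}(subnK (ltnW hd)) addn1 exprS.
  have n0 : 2 ^+ (d - 1) != 0 :> R by rewrite expf_neq0.
  by rewrite expr_div_n E; field.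
by apply: ler_wpM2l => //; rewrite mulr_ge0// ltW.
Qed.
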